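(* Assume (A.a) and (A.b). Let $\beta\in[0,1)$, $\lambda\in[0,\frac{\beta}{1-\beta}]$, step sizes $\alpha_k\in\big(0,\frac{(1-\beta)(1-\beta^m)}{4Lm}\big]$ for all $k$, let the sequences be generated by RRM, and let $T\ge1$. (a) (Arbitrary permutations.) If $\sum_{k=1}^T\alpha_k^3\le\frac{1}{Dm^3}$, then \[ \min_{k=1,\dots,T}\|\nabla f(x^k)\|^2\le\frac{1+3Dm^3\sum_{k=1}^T\alpha_k^3}{m\sum_{k=1}^T\alpha_k}\cdot16(1-\beta)[f(x^1)-\bar f]. \] (b) If in addition (A.c) holds and $\sum_{k=1}^T\alpha_k^3\le\frac{b}{Dm^2}$, then \[ \min_{k=1,\dots,T}\mathbb E[\|\nabla f(x^k)\|^2]\le\frac{1+3Dm^2b^{-1}\sum_{k=1}^T\alpha_k^3}{m\sum_{k=1}^T\alpha_k}\cdot16(1-\beta)[f(x^1)-\bar f]. \]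
   Context: Let $n,d\in\mathbb N$, $f_1,\dots,f_n:\mathbb R^d\to\mathbb R$ continuously differentiable, $f:=\frac1n\sum_{i=1}^n f_i$, $[n]:=\{1,\dots,n\}$. Fix a mini-batch size $b\in\mathbb N$ with $m:=n/b\in\mathbb N$. Random reshuffling with momentum (RRM) with step sizes $\{\alpha_k\}_{k\ge1}\subset(0,\infty)$ and parameters $\beta,\lambda$ generates sequences as follows: start with $x^1=\tilde x^1\in\mathbb R^d$; for each $k=1,2,\dots$ choose a permutation $\pi^k=(\pi^k_1,\dots,\pi^k_n)$ of $[n]$, set $y_0^k=\tilde x^k$, $y_1^k=x^k$, and for $i=1,\dots,m$ compute $\hat y_i^k=y_i^k+\lambda(y_i^k-y_{i-1}^k)$, $d_i^k=\frac1b\sum_{j=(i-1)b+1}^{ib}\nabla f_{\pi^k_j}(\hat y_i^k)$, $y_{i+1}^k=y_i^k-\alpha_kd_i^k+\beta(y_i^k-y_{i-1}^k)$; then set $\tilde x^{k+1}=y_m^k$, $x^{k+1}=y_{m+1}^k$. Assumption (A.a): there are $L>0$ and $\bar f\in\mathbb R$ such that each $\nabla f_i$ is $L$-Lipschitz and $f_i(x)\ge\bar f$ for all $x\in\mathbb R^d$, $i\in[n]$. Assumption (A.b): $\{\alpha_k\}_k$ is non-increasing. Assumption (A.c): the permutations $\pi^1,\pi^2,\dots$ are independent and each is uniformly distributed over all permutations of $[n]$. Constant: $D:=\frac{10}{(1-\beta^m)^2}\big(\frac{L}{1-\beta}\big)^3$. *)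

(* Defs.v *)
From HB Require Import structures.
From mathcomp Require Import all_boot all_order all_algebra all_fingroup.
From mathcomp Require Import all_classical all_reals all_analysis.
Set Implicit Arguments. Unset Strict Implicit. Unset Printing Implicit Defensive.
Import Order.TTheory GRing.Theory Num.Theory.
Import numFieldNormedType.Exports.
Local Open Scope ring_scope.

Section RRM.
Variables (R : realType) (d n : nat).
Local Notation V := 'rV[R]_d.

Definition dotv (u v : V) : R := \sum_(j < d) u 0 j * v 0 j.
Definition enorm (u : V) : R := Num.sqrt (dotv u u).

Definition favg (F : 'I_n -> V -> R) (x : V) : R := n%:R^-1 * \sum_(i < n) F i x.
Definition gavg (G : 'I_n -> V -> V) (x : V) : V := n%:R^-1 *: \sum_(i < n) G i x.

(* One inner step i (0-based, i = 0..m-1, i.e. paper index i+1) of an epoch.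
   State (y_{i-1}, y_i) in paper indexing; returns (y_i, y_{i+1}).
   The mini-batch consists of the paper indices j = (i)b+1 .. (i+1)b, i.e.
   0-based positions i*b <= j < i*b + b of the permutation. *)
Definition rrm_inner (G : 'I_n -> V -> V) (b : nat) (p : 'S_n)
  (a beta lam : R) (i : nat) (st : V * V) : V * V :=
  let: (yprev, y) := st in
  let yh := y + lam *: (y - yprev) in
  let dd := b%:R^-1 *: \sum_(j < n | (i * b <= j < i * b + b)%N) G (p j) yh in
  (y, y - a *: dd + beta *: (y - yprev)).

Definition rrm_epoch (G : 'I_n -> V -> V) (m b : nat) (p : 'S_n)
  (a beta lam : R) (st : V * V) : V * V :=
  iteri m (rrm_inner G b p a beta lam) st.

(* rrm_st k = (x~^{k+1}, x^{k+1}); epoch k uses permutation pi k and step alpha k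
   (both indexed from 1 as in the paper). *)
Fixpoint rrm_st (G : 'I_n -> V -> V) (m b : nat) (pi : nat -> 'S_n)
  (alpha : nat -> R) (beta lam : R) (x1 : V) (k : nat) : V * V :=
  match k with
  | 0 => (x1, x1)
  | k'.+1 => rrm_epoch G m b (pi k) (alpha k) beta lam
               (rrm_st G m b pi alpha beta lam x1 k')
  end.

Definition rrm_x G m b pi alpha beta lam x1 (k : nat) : V :=
  (rrm_st G m b pi alpha beta lam x1 k.-1).2.

(* The permutation sequence pi^1, ..., pi^T encoded by P : {ffun 'I_T -> 'S_n}
   (pi^k = P (k-1)); beyond T it is set to the identity (irrelevant for x^k, k <= T). *)
Definition perm_seq (T : nat) (P : {ffun 'I_T -> 'S_n}) (k : nat) : 'S_n :=
  match insub k.-1 with Some i => P i | None => 1%g end.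

(* Expectation of h under (A.c): pi^1, ..., pi^T independent, each uniform on
   the permutations of [n]; i.e. the uniform average over all T-tuples. *)
Definition Eperm (T : nat) (h : (nat -> 'S_n) -> R) : R :=
  #|{ffun 'I_T -> 'S_n}|%:R^-1 * \sum_(P : {ffun 'I_T -> 'S_n}) h (perm_seq P).

End RRM.

(* Main.v *)
Require Import Defs.
From HB Require Import structures.
From mathcomp Require Import all_boot all_order all_algebra all_fingroup.
From mathcomp Require Import all_classical all_reals all_analysis.
From mathcomp Require Import ring lra.
Set Implicit Arguments. Unset Strict Implicit. Unset Printing Implicit Defensive.
Import Order.TTheory GRing.Theory Num.Theory.
Import numFieldNormedType.Exports.
Local Open Scope ring_scope.

(* With [h = alpha / (1 - beta)], [v_i = y_i - y_{i-1}] and the shadow iterates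
   [z_i = y_i + beta / (1 - beta) v_i], one inner step reads [z_{i+1} = z_i - h d_i] and
   [v_{i+1} = beta v_i - alpha d_i], so that over an epoch [z] performs an inexact gradient
   step of length [h m].  Writing [d_l = grad f(z_0) + zeta_l + e_l], where [zeta_l] is the
   centered mini-batch gradient at [z_0] and [e_l] is the Lipschitz error of moving to the
   extrapolated point, the function [f(z) - fbar + mu |v|^2] decreases along an epoch up to
   terms [|sum_l w_l zeta_l|^2] with weights [w_l] in [[0, 1]].  Such a term, over [k]
   mini-batches, is at most [k kappa] times the variance [1/n sum_i |grad f_i - grad f|^2],
   with [kappa = m] by Cauchy-Schwarz for any permutation, and with [kappa = 1/b] in mean for
   a uniform one, since covariances of sampling without replacement are nonpositive.  The
   variance is at most [2 L (f(z) - fbar)], so both parts reduce to the recursion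
   [M_{k+1} + h_k m / 16 |grad f(x^k)|^2 <= (1 + 7/6 D m^2 kappa alpha_k^3) M_k]. *)


(** * Euclidean geometry and smooth functions *)

Lemma dotvC (R : realType) (d : nat) (u v : 'rV[R]_d) : dotv u v = dotv v u.
Proof. by apply: eq_bigr => j _; rewrite mulrC. Qed.

Lemma dotvDl (R : realType) (d : nat) (u v w : 'rV[R]_d) :
  dotv (u + v) w = dotv u w + dotv v w.
Proof. by rewrite /dotv -big_split; apply: eq_bigr => j _; rewrite mxE mulrDl. Qed.

Lemma dotvZl (R : realType) (d : nat) (a : R) (u v : 'rV[R]_d) :
  dotv (a *: u) v = a * dotv u v.
Proof. by rewrite /dotv mulr_sumr; apply: eq_bigr => j _; rewrite mxE mulrA. Qed.

Lemma dotvDr (R : realType) (d : nat) (u v w : 'rV[R]_d) :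
  dotv w (u + v) = dotv w u + dotv w v.
Proof. by rewrite dotvC dotvDl !(dotvC w). Qed.

Lemma dotvZr (R : realType) (d : nat) (a : R) (u v : 'rV[R]_d) :
  dotv u (a *: v) = a * dotv u v.
Proof. by rewrite dotvC dotvZl dotvC. Qed.

Lemma dotvNl (R : realType) (d : nat) (u v : 'rV[R]_d) : dotv (- u) v = - dotv u v.
Proof. by rewrite -scaleN1r dotvZl mulN1r. Qed.

Lemma dotvNr (R : realType) (d : nat) (u v : 'rV[R]_d) : dotv u (- v) = - dotv u v.
Proof. by rewrite dotvC dotvNl dotvC. Qed.

Lemma dotv0l (R : realType) (d : nat) (v : 'rV[R]_d) : dotv 0 v = 0.
Proof. by rewrite -(scale0r 0) dotvZl mul0r. Qed.

Lemma dotv_suml (R : realType) (d : nat) (I : Type) (r : seq I) (P : pred I)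
  (u : I -> 'rV[R]_d) (v : 'rV[R]_d) :
  dotv (\sum_(i <- r | P i) u i) v = \sum_(i <- r | P i) dotv (u i) v.
Proof.
by apply: (big_morph (fun x => dotv x v)) => [x y|]; rewrite ?dotvDl ?dotv0l.
Qed.

Lemma dotv_sumr (R : realType) (d : nat) (I : Type) (r : seq I) (P : pred I)
  (u : I -> 'rV[R]_d) (v : 'rV[R]_d) :
  dotv v (\sum_(i <- r | P i) u i) = \sum_(i <- r | P i) dotv v (u i).
Proof. by rewrite dotvC dotv_suml; apply: eq_bigr => i _; rewrite dotvC. Qed.

Definition dotvE := (dotvDl, dotvDr, dotvZl, dotvZr, dotvNl, dotvNr).

Definition normsq (R : realType) (d : nat) (u : 'rV[R]_d) : R := dotv u u.

Lemma normsq_ge0 (R : realType) (d : nat) (u : 'rV[R]_d) : 0 <= normsq u.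
Proof. by apply: sumr_ge0 => j _; rewrite -expr2 sqr_ge0. Qed.

Lemma enorm_sqr (R : realType) (d : nat) (u : 'rV[R]_d) : enorm u ^+ 2 = normsq u.
Proof. by rewrite sqr_sqrtr // normsq_ge0. Qed.

Lemma normsq0 (R : realType) (d : nat) : normsq (0 : 'rV[R]_d) = 0.
Proof. exact: dotv0l. Qed.

Lemma normsqZ (R : realType) (d : nat) (a : R) (u : 'rV[R]_d) :
  normsq (a *: u) = a ^+ 2 * normsq u.
Proof. by rewrite /normsq !dotvE mulrA. Qed.

Lemma normsqN (R : realType) (d : nat) (u : 'rV[R]_d) : normsq (- u) = normsq u.
Proof. by rewrite /normsq !dotvE opprK. Qed.

Lemma normsq_young (R : realType) (d : nat) (t : R) (u v : 'rV[R]_d) : 0 < t ->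
  normsq (u + v) <= (1 + t) * normsq u + (1 + t^-1) * normsq v.
Proof.
move=> t0; have := normsq_ge0 (t *: u - v); rewrite /normsq !dotvE (dotvC v u) => H.
suff : t * (dotv u v *+ 2) <= t * (t * dotv u u + t^-1 * dotv v v).
  by rewrite ler_pM2l //; lra.
have -> : t * (t * dotv u u + t^-1 * dotv v v) = t ^+ 2 * dotv u u + dotv v v.
  by field; rewrite gt_eqF.
by lra.
Qed.

Lemma normsqD2 (R : realType) (d : nat) (u v : 'rV[R]_d) :
  normsq (u + v) <= 2 * normsq u + 2 * normsq v.
Proof. by have := normsq_young u v ltr01; rewrite invr1; lra. Qed.

(** Convexity of the squared norm at the points [u] and [v / (1 - t)]. With [t = beta ^+ m] it keeps
    the contraction of the momentum over an epoch exact, at the price of [1 / (1 - beta ^+ m)] on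
    the rest. *)
Lemma normsq_convex (R : realType) (d : nat) (t : R) (u v : 'rV[R]_d) :
  0 <= t -> t < 1 -> normsq (t *: u + v) <= t * normsq u + (1 - t)^-1 * normsq v.
Proof.
move=> t0 t1; have s0 : 0 < 1 - t by lra.
rewrite -(ler_pM2l s0) mulrDr mulVKf ?gt_eqF //.
have := mulr_ge0 t0 (normsq_ge0 ((1 - t) *: u - v)).
rewrite /normsq !dotvE (dotvC v u); nra.
Qed.

(** Cauchy-Schwarz by Lagrange's identity: the double sum of [|w_i u_j - w_j u_i|^2] is twice the
    difference of the two sides. *)
Lemma normsq_sum_le (R : realType) (d : nat) (I : finType) (P : pred I) (w : I -> R)
  (u : I -> 'rV[R]_d) :
  normsq (\sum_(i | P i) w i *: u i) <= (\sum_(i | P i) w i ^+ 2) * \sum_(i | P i) normsq (u i).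
Proof.
have : 0 <= \sum_(i | P i) \sum_(j | P j) normsq (w i *: u j - w j *: u i).
  by apply: sumr_ge0 => i _; apply: sumr_ge0 => j _; exact: normsq_ge0.
have -> : \sum_(i | P i) \sum_(j | P j) normsq (w i *: u j - w j *: u i) =
    \sum_(i | P i) \sum_(j | P j) (w i ^+ 2 * normsq (u j))
    + \sum_(i | P i) \sum_(j | P j) (w j ^+ 2 * normsq (u i))
    - 2 * \sum_(i | P i) \sum_(j | P j) dotv (w i *: u i) (w j *: u j).
  rewrite mulr_sumr -big_split -sumrB; apply: eq_bigr => i _ /=.
  rewrite mulr_sumr -big_split -sumrB; apply: eq_bigr => j _ /=.
  by rewrite /normsq !dotvE (dotvC (u j) (u i)); ring.
rewrite [X in _ + X - _]exchange_big /=.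
have -> : \sum_(i | P i) \sum_(j | P j) (w i ^+ 2 * normsq (u j)) =
    (\sum_(i | P i) w i ^+ 2) * \sum_(i | P i) normsq (u i).
  by rewrite mulr_suml; apply: eq_bigr => i _; rewrite mulr_sumr.
have -> : \sum_(i | P i) \sum_(j | P j) dotv (w i *: u i) (w j *: u j) =
    normsq (\sum_(i | P i) w i *: u i).
  by rewrite /normsq dotv_suml; apply: eq_bigr => i _; rewrite dotv_sumr.
by lra.
Qed.

Lemma dotv_le_enorm (R : realType) (d : nat) (u v : 'rV[R]_d) :
  dotv u v <= enorm u * enorm v.
Proof.
suff H : dotv u v ^+ 2 <= normsq u * normsq v.
  apply: le_trans (ler_norm _) _.
  by rewrite -sqrtrM ?normsq_ge0 // -sqrtr_sqr ler_sqrt // mulr_ge0 // normsq_ge0.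
have [u0|u0] := eqVneq (normsq u) 0.
  have Hu (j : 'I_d) : u 0 j = 0.
    move: u0; rewrite /normsq /dotv => /eqP; rewrite psumr_eq0 => [|i _]; last first.
      by rewrite -expr2 sqr_ge0.
    by move=> /allP /(_ j (mem_index_enum _)) /=; rewrite mulf_eq0 orbb => /eqP.
  rewrite u0 mul0r [dotv u v]big1 ?expr0n // => j _; by rewrite Hu mul0r.
have up : 0 < normsq u by rewrite lt0r u0 normsq_ge0.
(* This square equals [|u|^2 (|u|^2 |v|^2 - <u, v>^2)], and its first factor is now positive. *)
have := normsq_ge0 (normsq u *: v - dotv u v *: u).
rewrite {1}/normsq !dotvE (dotvC v u) -/(normsq u) -/(normsq v) => H.
by rewrite -(ler_pM2l up); lra.
Qed.

Lemma lipschitz_normsq (R : realType) (d : nat) (L : R) (u v : 'rV[R]_d) :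
  enorm u <= L * enorm v -> normsq u <= L ^+ 2 * normsq v.
Proof.
move=> H; rewrite -!enorm_sqr -exprMn ler_sqr // nnegrE ?sqrtr_ge0 //.
exact: le_trans (sqrtr_ge0 _) H.
Qed.

(** The mean value theorem is applied along the segment to [F] minus the claimed quadratic bound;
    the Lipschitz gradient and Cauchy-Schwarz make the derivative of this difference nonpositive. *)
Lemma descent_lemma (R : realType) (d : nat) (F : 'rV[R]_d -> R)
  (G : 'rV[R]_d -> 'rV[R]_d) (L : R) :
  0 < L -> (forall x, differentiable F x) -> (forall x h, 'd F x h = dotv (G x) h) ->
  (forall x y, enorm (G x - G y) <= L * enorm (x - y)) ->
  forall x h, F (x + h) <= F x + dotv (G x) h + L / 2 * normsq h.
Proof.
move=> L0 dF GF LG x h.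
pose phi (t : R) := F (x + t *: h) - (dotv (G x) h * t + L / 2 * normsq h * t ^+ 2).
have dphi (t : R) : is_derive t 1 phi
    (dotv (G (x + t *: h)) h - (dotv (G x) h + L * normsq h * t)).
  have dl : is_diff t (fun s : R => x + s *: h) (fun s : R => s *: h).
    by apply: is_diff_eq; rewrite add0r.
  have dFt : is_diff (x + t *: h) F ('d F (x + t *: h)).
    exact: differentiableP.
  have dc := is_diff_comp dl dFt.
  have dFl : is_derive t 1 (fun s : R => F (x + s *: h)) (dotv (G (x + t *: h)) h).
    have ec : differentiable (fun s : R => F (x + s *: h)) t by case: dc.
    split; first exact/diff_derivable.
    rewrite deriveE //; have -> : 'd (fun s : R => F (x + s *: h)) t =
      (fun s : R => 'd F (x + t *: h) (s *: h)) :> (R -> R) by case: dc.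
    by rewrite scale1r GF.
  have dq : is_derive t 1 (fun s : R => dotv (G x) h * s + L / 2 * normsq h * s ^+ 2)
      (dotv (G x) h + L * normsq h * t).
    apply: is_derive_eq.
    by rewrite /GRing.scale /=; field.
  exact: is_deriveB.
have cphi : ({within `[0, 1], continuous phi})%classic.
  apply: continuous_subspaceT => t.
  apply: differentiable_continuous; apply/derivable1_diffP.
  by case: (dphi t).
have [c /[!in_itv]/= /andP[c0 c1] H] := @MVT_segment _ phi _ 0 1 ler01 (fun t _ => dphi t) cphi.
have : phi 1 - phi 0 <= 0.
  rewrite H subr0 mulr1.
  have -> : dotv (G (x + c *: h)) h - (dotv (G x) h + L * normsq h * c) =
    dotv (G (x + c *: h) - G x) h - L * normsq h * c by rewrite !dotvE; ring.
  rewrite subr_le0; apply: le_trans (dotv_le_enorm _ _) _.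
  have := LG (x + c *: h) x; rewrite {2}(addrC x) addrK => Hc.
  have -> : L * normsq h * c = L * enorm (c *: h) * enorm h.
    rewrite -enorm_sqr.
    have -> : enorm (c *: h) = c * enorm h.
      by rewrite /enorm -/(normsq _) normsqZ sqrtrM ?sqr_ge0 // sqrtr_sqr ger0_norm.
    by ring.
  by apply: ler_wpM2r Hc; exact: sqrtr_ge0.
rewrite /phi scale1r scale0r addr0 mulr1 expr1n mulr1 mulr0 expr0n mulr0.
by lra.
Qed.


(** * One epoch of the heavy-ball recursion *)

Lemma sum_ord_le_half_sqr (R : realType) (m : nat) :
  \sum_(i < m) (i%:R : R) <= m%:R ^+ 2 / 2.
Proof.
elim: m => [|m IH]; first by rewrite big_ord0 expr0n mul0r.
by rewrite big_ord_recr /= -(natr1 m); have := ler0n R m; lra.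
Qed.

Lemma momentum_closed (R : realType) (d : nat) (beta a : R) (v D : nat -> 'rV[R]_d) :
  (forall i, v i.+1 = beta *: v i - a *: D i) ->
  forall i, v i = beta ^+ i *: v 0%N - a *: \sum_(l < i) beta ^+ (i - l.+1) *: D l.
Proof.
move=> vS; elim=> [|i IH]; first by rewrite big_ord0 scaler0 subr0 expr0 scale1r.
rewrite vS IH big_ord_recr /= subnn expr0 scale1r exprS -scalerA.
rewrite scalerBr scalerDr opprD addrA; congr (_ - _ - _).
rewrite scalerA mulrC -scalerA; congr (_ *: _).
rewrite scaler_sumr; apply: eq_bigr => l _.
by rewrite scalerA -exprS -subSn.
Qed.

Lemma shadow_closed (R : realType) (d : nat) (h : R) (z D : nat -> 'rV[R]_d) :
  (forall i, z i.+1 = z i - h *: D i) ->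
  forall i, z i = z 0%N - h *: \sum_(l < i) D l.
Proof.
move=> zS; elim=> [|i IH]; first by rewrite big_ord0 scaler0 subr0.
by rewrite zS IH big_ord_recr /= scalerDr opprD addrA.
Qed.

(** Coefficient of [- h D_l] in [z_i - c v_i - z_0]: [1] from the shadow iterate, less what [c v_i]
    still carries of [D_l]. *)
Definition drift_weight (R : realType) (c beta : R) (i l : nat) : R :=
  1 - c * (1 - beta) * beta ^+ (i - l.+1).

Lemma drift_weight_itv (R : realType) (c beta : R) (i l : nat) :
  0 <= beta -> beta < 1 -> 0 <= c -> c * (1 - beta) <= 1 ->
  0 <= drift_weight c beta i l <= 1.
Proof.
move=> b0 b1 c0 c1; rewrite /drift_weight.
have p0 : 0 <= beta ^+ (i - l.+1) by exact: exprn_ge0.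
have p1 : beta ^+ (i - l.+1) <= 1 by apply: exprn_ile1 => //; exact: ltW.
have q0 : 0 <= c * (1 - beta) by apply: mulr_ge0 => //; rewrite subr_ge0 ltW.
have := mulr_ile1 q0 p0 c1 p1; have := mulr_ge0 q0 p0.
by move=> *; apply/andP; split; lra.
Qed.

Lemma sum_sqr_itv (R : realType) (k : nat) (w : 'I_k -> R) :
  (forall l, 0 <= w l <= 1) -> \sum_l w l ^+ 2 <= k%:R.
Proof.
move=> hw; rewrite -[X in _ <= X%:R](card_ord k) -sumr_const; apply: ler_sum => l _.
by case/andP: (hw l) => *; exact: exprn_ile1.
Qed.

Lemma drift_closed (R : realType) (d : nat) (beta c h : R) (v z D : nat -> 'rV[R]_d) :
  (forall i, v i.+1 = beta *: v i - (h * (1 - beta)) *: D i) ->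
  (forall i, z i.+1 = z i - h *: D i) ->
  forall i, z i - c *: v i - z 0%N =
    - ((c * beta ^+ i) *: v 0%N + h *: \sum_(l < i) drift_weight c beta i l *: D l).
Proof.
move=> vS zS i; rewrite (shadow_closed zS) (momentum_closed vS).
have -> : \sum_(l < i) drift_weight c beta i l *: D l =
    \sum_(l < i) D l - (c * (1 - beta)) *: \sum_(l < i) beta ^+ (i - l.+1) *: D l.
  rewrite scaler_sumr -sumrB; apply: eq_bigr => l _.
  by rewrite scalerBl scale1r scalerA.
set S := \sum_(l < i) D l; set P := \sum_(l < i) _.
by apply/rowP => j; rewrite !mxE; ring.
Qed.

(** The errors [e_l] are bounded by the drift itself, which thus appears on both sides. Its
    coefficient on the right is [4 (L h m)^2 <= 1/4], and solving for it gives the factor [4/3]. *)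
Lemma drift_sum_le (R : realType) (d m : nat) (beta c h L : R)
  (v z D zeta e : nat -> 'rV[R]_d) (g : 'rV[R]_d) :
  0 <= beta -> beta < 1 -> 0 <= c -> c * (1 - beta) <= 1 -> 0 <= h -> 0 <= L ->
  4 * (L * h * m%:R) <= 1 ->
  (forall i, v i.+1 = beta *: v i - (h * (1 - beta)) *: D i) ->
  (forall i, z i.+1 = z i - h *: D i) ->
  (forall l, (l < m)%N -> D l = g + zeta l + e l) ->
  (forall l, (l < m)%N ->
     normsq (e l) <= L ^+ 2 * normsq (z l - c *: v l - z 0%N)) ->
  \sum_(i < m) normsq (z i - c *: v i - z 0%N) <=
    4 / 3 * (2 * c ^+ 2 * m%:R * normsq (v 0%N) + 4 * h ^+ 2 * m%:R ^+ 3 * normsq g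
      + 4 * h ^+ 2 *
        \sum_(i < m) normsq (\sum_(l < i) drift_weight c beta i l *: zeta l)).
Proof.
move=> b0 b1 c0 c1 h0 L0 hu vS zS Dl el.
set Delta := \sum_(i < m) _.
pose w := drift_weight c beta.
have w01 i l : 0 <= w i l <= 1 by exact: drift_weight_itv.
have Delta0 : 0 <= Delta by apply: sumr_ge0 => i _; exact: normsq_ge0.
have step (i : 'I_m) : normsq (z i - c *: v i - z 0%N) <=
    2 * c ^+ 2 * normsq (v 0%N)
    + (8 * h ^+ 2 * m%:R * normsq g + 8 * h ^+ 2 * L ^+ 2 * Delta) * i%:R
    + 4 * h ^+ 2 * normsq (\sum_(l < i) w i l *: zeta l).
  rewrite (drift_closed c vS zS) normsqN.
  have -> : \sum_(l < i) drift_weight c beta i l *: D l =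
      \sum_(l < i) w i l *: zeta l
      + (\sum_(l < i) w i l *: g + \sum_(l < i) w i l *: e l).
    rewrite -!big_split; apply: eq_bigr => l _ /=.
    rewrite Dl ?(ltn_trans (ltn_ord l)) // -!scalerDr; congr (_ *: _).
    by rewrite addrAC addrC addrA.
  set Z := \sum_(l < i) w i l *: zeta l.
  have A1 : normsq ((c * beta ^+ i) *: v 0%N) <= c ^+ 2 * normsq (v 0%N).
    rewrite normsqZ exprMn; apply: ler_wpM2r; first exact: normsq_ge0.
    rewrite -[leRHS]mulr1; apply: ler_wpM2l; first exact: sqr_ge0.
    by rewrite -exprM; apply: exprn_ile1 => //; exact: ltW.
  (* Bounding one of the two factors [i] by [m] keeps the estimate linear in [i], like [A3], so that
     a single sum of the [i] serves both. *)
  have A2 : normsq (\sum_(l < i) w i l *: g) <= m%:R * i%:R * normsq g.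
    apply: le_trans (normsq_sum_le _ _ _) _.
    rewrite sumr_const card_ord -[normsq g *+ i]mulr_natl mulrA.
    apply: ler_wpM2r; first exact: normsq_ge0.
    apply: ler_wpM2r; first exact: ler0n.
    apply: le_trans (sum_sqr_itv (fun l => w01 _ _)) _.
    by rewrite ler_nat ltnW.
  have A3 : normsq (\sum_(l < i) w i l *: e l) <= i%:R * (L ^+ 2 * Delta).
    apply: le_trans (normsq_sum_le _ _ _) _.
    apply: ler_pM; first by apply: sumr_ge0 => *; exact: sqr_ge0.
    - by apply: sumr_ge0 => *; exact: normsq_ge0.
    - exact: sum_sqr_itv.
    rewrite mulr_sumr.
    apply: le_trans (_ : \sum_(l < i) L ^+ 2 * normsq (z l - c *: v l - z 0%N) <= _).
      by apply: ler_sum => l _; apply: el; exact: ltn_trans (ltn_ord l) _.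
    rewrite -!(big_mkord xpredT (fun l => L ^+ 2 * normsq (z l - c *: v l - z 0%N))).
    rewrite [leRHS](big_cat_nat (n := i)) //= ?(ltnW (ltn_ord i)) //.
    rewrite lerDl; apply: sumr_ge0 => l _; apply: mulr_ge0; [exact: sqr_ge0|exact: normsq_ge0].
  have B1 := normsqD2 ((c * beta ^+ i) *: v 0%N)
    (h *: (Z + (\sum_(l < i) w i l *: g + \sum_(l < i) w i l *: e l))).
  have B2 := normsqD2 Z (\sum_(l < i) w i l *: g + \sum_(l < i) w i l *: e l).
  have B3 := normsqD2 (\sum_(l < i) w i l *: g) (\sum_(l < i) w i l *: e l).
  apply: le_trans B1 _; rewrite (normsqZ h).
  have hh : 0 <= h ^+ 2 by exact: sqr_ge0.
  have B4 : normsq (Z + (\sum_(l < i) w i l *: g + \sum_(l < i) w i l *: e l)) <=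
     2 * normsq Z + 4 * (m%:R * i%:R * normsq g) + 4 * (i%:R * (L ^+ 2 * Delta)) by lra.
  have B5 := ler_wpM2l hh B4.
  by lra.
have : Delta <= \sum_(i < m) (2 * c ^+ 2 * normsq (v 0%N)
    + (8 * h ^+ 2 * m%:R * normsq g + 8 * h ^+ 2 * L ^+ 2 * Delta) * i%:R
    + 4 * h ^+ 2 * normsq (\sum_(l < i) w i l *: zeta l)).
  by apply: ler_sum => i _; exact: step.
rewrite !big_split /= sumr_const card_ord -[_ *+ m in leRHS]mulr_natr -!mulr_sumr.
have G0 := normsq_ge0 g.
have P0 : 0 <= 8 * h ^+ 2 * m%:R * normsq g + 8 * h ^+ 2 * L ^+ 2 * Delta.
  by rewrite addr_ge0 ?mulr_ge0 ?sqr_ge0.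
have := ler_wpM2l P0 (sum_ord_le_half_sqr R m).
have u0 : 0 <= L * h * m%:R by rewrite !mulr_ge0.
have : (L * h * m%:R) ^+ 2 * Delta <= 1 / 16 * Delta.
  by apply: ler_wpM2r => //; nra.
by rewrite -/w; lra.
Qed.


(** Numbers in [[0, 1]] satisfy [p^2 <= p], so their variance is at most [q (1 - q) <= 1/4], where
    [q = s / m] is their mean. These deviations will weigh the errors [e_l] in the momentum. *)
Lemma sum_pow_rev_dev_le (R : realType) (beta : R) (m : nat) : (0 < m)%N ->
  0 <= beta -> beta < 1 ->
  let s := \sum_(l < m) beta ^+ (m - l.+1) in
  [/\ 0 <= s, s <= m%:R &
      \sum_(l < m) (beta ^+ (m - l.+1) - s / m%:R) ^+ 2 <= m%:R / 4].
Proof.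
move=> m0 b0 b1 s.
have M0 : 0 < m%:R :> R by rewrite ltr0n.
have p01 (l : 'I_m) : 0 <= beta ^+ (m - l.+1) <= 1.
  by rewrite exprn_ge0 //= exprn_ile1 // ltW.
have s0 : 0 <= s by apply: sumr_ge0 => l _; case/andP: (p01 l).
have sm : s <= m%:R.
  rewrite -[X in _ <= X%:R](card_ord m) -sumr_const; apply: ler_sum => l _.
  by case/andP: (p01 l).
split=> //.
have : \sum_(l < m) (beta ^+ (m - l.+1) - s / m%:R) ^+ 2 <=
    \sum_(l < m) (beta ^+ (m - l.+1) * (1 - 2 * (s / m%:R)) + (s / m%:R) ^+ 2).
  by apply: ler_sum => l _; case/andP: (p01 l) => q0 q1; nra.
rewrite big_split /= -mulr_suml -/s sumr_const card_ord -[_ ^+ 2 *+ m]mulr_natr.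
move=> /le_trans; apply.
have -> : s * (1 - 2 * (s / m%:R)) + (s / m%:R) ^+ 2 * m%:R =
   m%:R / 4 - m%:R * (s / m%:R - 1 / 2) ^+ 2 by field; rewrite gt_eqF.
by rewrite gerBl mulr_ge0 ?sqr_ge0 // ltW.
Qed.

(** [X], [Gq], [H] stand for the squared norms of [v_0], [g] and the mean direction, [Delta] for the
    drift, [SQ] and [Qv] for the noise, [N] for the squared gradient at the iterate. The value of
    [mu] makes the contraction gain [mu rho X] equal to [2 h M L^2 B^2 X], which pays for the [X] in
    the drift ([11/6]) and in [N] ([1/8]). *)
Lemma lyapunov_arith (R : realType) (M h L beta rho B s X Gq H Delta SQ Qv N f0 fm vm mu : R) :
  0 < M -> 0 < h -> 0 < L -> 0 <= beta -> beta < 1 -> 0 < rho -> rho <= 1 ->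
  B * (1 - beta) = beta -> 0 <= s -> s <= M -> 4 * (L * h * M) <= rho ->
  0 <= X -> 0 <= Gq -> 0 <= H -> 0 <= Delta -> 0 <= SQ -> 0 <= Qv ->
  Delta <= 4 / 3 * (2 * B ^+ 2 * M * X + 4 * h ^+ 2 * M ^+ 3 * Gq + 4 * h ^+ 2 * SQ) ->
  fm <= f0 - h * M / 2 * Gq - 3 / 8 * (h * M) * H + h * L ^+ 2 / 2 * Delta ->
  vm <= (1 - rho) * X + rho^-1 * ((h * (1 - beta)) ^+ 2 *
     (3 * s ^+ 2 * H + 2 * Qv + 3 / 2 * M * L ^+ 2 * Delta)) ->
  N <= 2 * Gq + 2 * L ^+ 2 * B ^+ 2 * X ->
  mu = 2 * (h * M) * L ^+ 2 * B ^+ 2 / rho ->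
  fm + mu * vm + h * M / 16 * N <=
    f0 + mu * X + 11 / 3 * L ^+ 2 * h ^+ 3 * SQ + 4 * M * L ^+ 2 * h ^+ 3 / rho ^+ 2 * Qv.
Proof.
move=> M0 h0 L0 b0 b1 r0 r1 HB s0 sM hu X0 G0 H0 D0 S0 Q0 HD Hf Hv HN ->.
clear mu; set mu := 2 * (h * M) * L ^+ 2 * B ^+ 2 / rho.
pose r := L * h / rho.
have rp : 0 < r by rewrite divr_gt0 ?mulr_gt0.
have gp : 0 < h * M by rewrite mulr_gt0.
have rM : M * r <= 1 / 4.
  by rewrite /r mulrA ler_pdivrMr //; lra.
have Bp : 0 <= B by rewrite -(pmulr_lge0 _ (_ : 0 < 1 - beta)) ?HB // subr_gt0.
have mu0 : 0 <= mu by rewrite /mu !mulr_ge0 ?invr_ge0 // ltW.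
have B0 : 0 <= B ^+ 2 by exact: sqr_ge0.
have nuE : mu * (rho^-1 * (h * (1 - beta)) ^+ 2) = 2 * (h * M) * beta ^+ 2 * r ^+ 2.
  by rewrite /mu /r -{2}HB; field; rewrite gt_eqF.
have bb : 0 <= beta ^+ 2 <= 1 by rewrite sqr_ge0 exprn_ile1 // ltW.
have rs : (r * s) ^+ 2 <= 1 / 16.
  have : 0 <= r * s by rewrite mulr_ge0 // ltW.
  have : r * s <= 1 / 4 by apply: le_trans rM; rewrite mulrC ler_wpM2r // ltW.
  by nra.
have rMM : (M * r) ^+ 2 <= 1 / 16.
  have : 0 < M * r by rewrite mulr_gt0.
  by nra.
(* The growth of the momentum may consume the whole [3/8] of [H] that the descent provides. Its
   share [3/16] of the drift, added to the [1/2] of the descent, makes the [11/16] below. *)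
have cH : 2 * (h * M) * beta ^+ 2 * r ^+ 2 * (3 * s ^+ 2) <= 3 / 8 * (h * M).
  have : beta ^+ 2 * (r * s) ^+ 2 <= 1 * (1 / 16).
    by apply: ler_pM => //; rewrite ?sqr_ge0 //; case/andP: bb.
  by move/(ler_wpM2l (ltW gp)); lra.
have cD : 2 * (h * M) * beta ^+ 2 * r ^+ 2 * (3 / 2 * M * L ^+ 2) <= 3 / 16 * (h * L ^+ 2).
  have : beta ^+ 2 * (M * r) ^+ 2 <= 1 * (1 / 16).
    by apply: ler_pM => //; rewrite ?sqr_ge0 //; case/andP: bb.
  have hl : 0 <= h * L ^+ 2 by rewrite mulr_ge0 ?sqr_ge0 // ltW.
  by move/(ler_wpM2l hl); lra.
have cQ : 2 * (h * M) * beta ^+ 2 * r ^+ 2 * 2 <= 4 * M * L ^+ 2 * h ^+ 3 / rho ^+ 2.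
  have -> : 4 * M * L ^+ 2 * h ^+ 3 / rho ^+ 2 = 4 * (h * M) * r ^+ 2.
    by rewrite /r; field; rewrite gt_eqF.
  have q0 : 0 <= (h * M) * r ^+ 2 by rewrite mulr_ge0 ?sqr_ge0 // ltW.
  by case/andP: bb => _ /(ler_wpM2l q0); lra.
have HV : mu * vm <= mu * X - 2 * (h * M) * L ^+ 2 * B ^+ 2 * X
    + 3 / 8 * (h * M) * H + 4 * M * L ^+ 2 * h ^+ 3 / rho ^+ 2 * Qv
    + 3 / 16 * (h * L ^+ 2) * Delta.
  apply: le_trans (ler_wpM2l mu0 Hv) _.
  have -> : mu * ((1 - rho) * X + rho^-1 * ((h * (1 - beta)) ^+ 2 *
     (3 * s ^+ 2 * H + 2 * Qv + 3 / 2 * M * L ^+ 2 * Delta))) =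
     mu * X - (mu * rho) * X + (mu * (rho^-1 * (h * (1 - beta)) ^+ 2)) *
     (3 * s ^+ 2 * H + 2 * Qv + 3 / 2 * M * L ^+ 2 * Delta) by ring.
  have -> : mu * rho = 2 * (h * M) * L ^+ 2 * B ^+ 2 by rewrite /mu; field; rewrite gt_eqF.
  rewrite nuE.
  have := ler_wpM2r H0 cH; have := ler_wpM2r Q0 cQ; have := ler_wpM2r D0 cD.
  by lra.
have hl : 0 <= 11 / 16 * (h * L ^+ 2) by rewrite !mulr_ge0 ?invr_ge0 // ltW.
have HD' := ler_wpM2l hl HD.
have cG : (L * h * M) ^+ 2 <= 1 / 16.
  have : 0 < L * h * M by rewrite !mulr_gt0.
  by nra.
have gG : 0 <= h * M * Gq by rewrite mulr_ge0 // ltW.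
(* In units of [h M Gq], the drift costs at most [11/48] and [N] costs [1/8], against the gain
   [1/2]. *)
have cG' := ler_wpM2l gG cG.
have HN' := ler_wpM2l (ltW gp) HN.
have gX : 0 <= h * M * L ^+ 2 * B ^+ 2 * X by rewrite !mulr_ge0 ?sqr_ge0 // ltW.
by lra.
Qed.

(** Since the [zeta_l] sum to zero, they drop out of [z_m - z_0] and hence of the descent
    inequality. Noise survives only in the drift, through partial sums, and in the final momentum,
    through the geometric weights. *)
Lemma epoch_descent (R : realType) (d m : nat) (beta c h L B f0 fm N rho mu : R)
  (v z D zeta e : nat -> 'rV[R]_d) (g : 'rV[R]_d) :
  (0 < m)%N -> 0 <= beta -> beta < 1 -> 0 < h -> 0 < L ->
  B * (1 - beta) = beta -> 0 <= c -> c <= B ->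
  4 * (L * h * m%:R) <= 1 - beta ^+ m ->
  (forall i, v i.+1 = beta *: v i - (h * (1 - beta)) *: D i) ->
  (forall i, z i.+1 = z i - h *: D i) ->
  (forall l, (l < m)%N -> D l = g + zeta l + e l) ->
  (forall l, (l < m)%N ->
     normsq (e l) <= L ^+ 2 * normsq (z l - c *: v l - z 0%N)) ->
  \sum_(l < m) zeta l = 0 ->
  fm <= f0 + dotv g (z m - z 0%N) + L / 2 * normsq (z m - z 0%N) ->
  N <= 2 * normsq g + 2 * L ^+ 2 * B ^+ 2 * normsq (v 0%N) ->
  rho = 1 - beta ^+ m ->
  mu = 2 * (h * m%:R) * L ^+ 2 * B ^+ 2 / rho ->
  fm + mu * normsq (v m) + h * m%:R / 16 * N <=
    f0 + mu * normsq (v 0%N)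
    + 11 / 3 * L ^+ 2 * h ^+ 3 *
      \sum_(i < m) normsq (\sum_(l < i) drift_weight c beta i l *: zeta l)
    + 4 * m%:R * L ^+ 2 * h ^+ 3 / rho ^+ 2 *
      normsq (\sum_(l < m) beta ^+ (m - l.+1) *: zeta l).
Proof.
move=> m0 b0 b1 h0 L0 HB c0 cB hu vS zS Dl el zeta0 Hf HN -> ->.
clear rho mu; set rho := 1 - beta ^+ m.
have M0 : 0 < m%:R :> R by rewrite ltr0n.
have bm1 : beta ^+ m < 1 by rewrite exprn_ilt1 // -lt0n.
have bm0 : 0 <= beta ^+ m by exact: exprn_ge0.
have rho0 : 0 < rho by rewrite /rho; lra.
have rho1 : rho <= 1 by rewrite /rho; lra.
have ob : 0 < 1 - beta by lra.
have [s0 sm sdev] := sum_pow_rev_dev_le m0 b0 b1.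
set s := \sum_(l < m) beta ^+ _ in s0 sm sdev.
have c1 : c * (1 - beta) <= 1.
  by apply: le_trans (ler_wpM2r (ltW ob) cB) _; rewrite HB ltW.
have hu1 : 4 * (L * h * m%:R) <= 1 by apply: le_trans hu _; exact: rho1.
have Hdrift := drift_sum_le b0 b1 c0 c1 (ltW h0) (ltW L0) hu1 vS zS Dl el.
set Delta := \sum_(i < m) normsq (z i - _ - _) in Hdrift.
set SQ := \sum_(i < m) normsq (\sum_(l < i) _) in Hdrift *.
have D0 : 0 <= Delta by apply: sumr_ge0 => i _; exact: normsq_ge0.
have S0 : 0 <= SQ by apply: sumr_ge0 => i _; exact: normsq_ge0.
have X0 := normsq_ge0 (v 0%N).
have eD : \sum_(l < m) normsq (e l) <= L ^+ 2 * Delta.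
  by rewrite mulr_sumr; apply: ler_sum => l _; exact: el.
pose eb := m%:R^-1 *: \sum_(l < m) e l.
(* The momentum is expressed through the mean direction [gb] of the epoch instead of [g], so
   that its growth is absorbed by the term [- 3/8 h m |gb|^2] of the descent inequality. *)
pose gb := g + eb.
have sumD : \sum_(l < m) D l = m%:R *: gb.
  rewrite (eq_bigr (fun l : 'I_m => g + zeta l + e l)) => [|l _]; last exact: Dl.
  rewrite !big_split /= zeta0 addr0 sumr_const card_ord -scaler_nat.
  by rewrite scalerDr scalerA divff ?gt_eqF // scale1r.
have ebD : normsq eb <= m%:R^-1 * (L ^+ 2 * Delta).
  rewrite /eb scaler_sumr; apply: le_trans (normsq_sum_le _ _ _) _.
  rewrite sumr_const card_ord.
  have -> : m%:R^-1 ^+ 2 *+ m = m%:R^-1 :> R.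
    by rewrite -[_ ^+ 2 *+ m]mulr_natr; field; rewrite gt_eqF.
  by rewrite ler_pM2l ?invr_gt0.
have Hdrift' : Delta <= 4 / 3 * (2 * B ^+ 2 * m%:R * normsq (v 0%N)
    + 4 * h ^+ 2 * m%:R ^+ 3 * normsq g + 4 * h ^+ 2 * SQ).
  apply: le_trans Hdrift _; rewrite ler_pM2l; last by lra.
  rewrite !lerD2r; apply: ler_wpM2r => //; apply: ler_wpM2r; first exact: ltW.
  rewrite ler_pM2l; last by lra.
  by rewrite ler_sqr // nnegrE //; exact: le_trans cB.
(* Polarization turns [- h m <g, gb>] into [- h m / 2] times [|g|^2 + |gb|^2 - |eb|^2]. Of the [1/2]
   on [|gb|^2], [3/8] remains after the quadratic term, which costs [L h m / 2 <= 1/8]. *)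
have ebE : normsq eb = normsq gb + normsq g - 2 * dotv g gb.
  by rewrite /gb /normsq !(dotvDl, dotvDr) [dotv eb g]dotvC; ring.
have Hdesc : fm <= f0 - h * m%:R / 2 * normsq g - 3 / 8 * (h * m%:R) * normsq gb
    + h * L ^+ 2 / 2 * Delta.
  apply: le_trans Hf _.
  have -> : z m - z 0%N = - (h * m%:R) *: gb.
    by rewrite (shadow_closed zS) sumD scalerA addrAC subrr add0r scaleNr.
  rewrite dotvZr normsqZ.
  have gp : 0 < h * m%:R by rewrite mulr_gt0.
  have := ler_wpM2l (ltW gp) ebD; rewrite ebE.
  have -> : h * m%:R * (m%:R^-1 * (L ^+ 2 * Delta)) = h * L ^+ 2 * Delta.
    by field; rewrite gt_eqF.
  have gg : 0 <= h * m%:R * normsq gb by rewrite mulr_ge0 ?normsq_ge0 // ltW.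
  have := ler_wpM2r gg hu1; lra.
have Hv : normsq (v m) <= (1 - rho) * normsq (v 0%N) + rho^-1 * ((h * (1 - beta)) ^+ 2 *
     (3 * s ^+ 2 * normsq gb + 2 * normsq (\sum_(l < m) beta ^+ (m - l.+1) *: zeta l)
      + 3 / 2 * m%:R * L ^+ 2 * Delta)).
  rewrite (momentum_closed vS).
  have -> : 1 - rho = beta ^+ m by rewrite /rho; lra.
  apply: le_trans (normsq_convex _ _ bm0 bm1) _; rewrite lerD2l -/rho.
  rewrite ler_pM2l ?invr_gt0 // normsqN normsqZ; apply: ler_wpM2l; first exact: sqr_ge0.
  (* As [gb] already contains the mean error, each [e_l] keeps only the deviation of its weight from
     the mean weight [s / m]. *)
  have -> : \sum_(l < m) beta ^+ (m - l.+1) *: D l =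
      \sum_(l < m) beta ^+ (m - l.+1) *: zeta l
      + (s *: gb + \sum_(l < m) (beta ^+ (m - l.+1) - s / m%:R) *: e l).
    have -> : \sum_(l < m) (beta ^+ (m - l.+1) - s / m%:R) *: e l =
        \sum_(l < m) beta ^+ (m - l.+1) *: e l - s *: eb.
      rewrite /eb scalerA scaler_sumr -sumrB.
      by apply: eq_bigr => l _; rewrite scalerBl.
    rewrite /gb scalerDr /s scaler_suml addrACA addrN addr0.
    rewrite -!big_split; apply: eq_bigr => l _ /=.
    by rewrite Dl // -!scalerDr; congr (_ *: _); rewrite addrAC addrC addrA.
  apply: le_trans (normsqD2 _ _) _.
  have t0 : 0 < 1 / 2 :> R by lra.
  have := normsq_young (s *: gb) (\sum_(l < m) (beta ^+ (m - l.+1) - s / m%:R) *: e l) t0.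
  have -> : 1 + (1 / 2)^-1 = 3 :> R by field.
  rewrite normsqZ.
  have : normsq (\sum_(l < m) (beta ^+ (m - l.+1) - s / m%:R) *: e l) <=
      m%:R / 4 * (L ^+ 2 * Delta).
    apply: le_trans (normsq_sum_le _ _ _) _.
    apply: ler_pM => //; apply: sumr_ge0 => *; [exact: sqr_ge0|exact: normsq_ge0].
  by lra.
exact: (lyapunov_arith M0 h0 L0 b0 b1 rho0 rho1 HB s0 sm hu X0 (normsq_ge0 _)
  (normsq_ge0 _) D0 S0 (normsq_ge0 _) Hdrift' Hdesc Hv HN erefl).
Qed.


(** A gradient step of length [1 / L] lowers [F] by at least [|G x|^2 / (2 L)], yet cannot go below
    [fbar]. *)
Lemma gradient_le_gap (R : realType) (d : nat) (F : 'rV[R]_d -> R)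
  (G : 'rV[R]_d -> 'rV[R]_d) (L fbar : R) :
  0 < L -> (forall x, fbar <= F x) ->
  (forall x h, F (x + h) <= F x + dotv (G x) h + L / 2 * normsq h) ->
  forall x, normsq (G x) <= 2 * L * (F x - fbar).
Proof.
move=> L0 Fb desc x.
have := le_trans (Fb _) (desc x (- L^-1 *: G x)).
rewrite dotvZr normsqZ -/(normsq (G x)) sqrrN => H.
have Lg : 0 < 2 * L by rewrite mulr_gt0.
have := ler_wpM2l (ltW Lg) H.
have -> : 2 * L * (F x + - L^-1 * normsq (G x) + L / 2 * (L^-1 ^+ 2 * normsq (G x))) =
  2 * L * F x - normsq (G x) by field; rewrite gt_eqF.
by lra.
Qed.

(** * Mini-batches and sampling without replacement *)

Definition in_batch (b l j : nat) : bool := (l * b <= j < l * b + b)%N.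

Lemma in_batchE (b l j : nat) : (0 < b)%N -> in_batch b l j = (j %/ b == l)%N.
Proof.
move=> b0; rewrite /in_batch -mulSnr -leq_divRL // -ltn_divLR // ltnS.
by rewrite eq_sym eqn_leq.
Qed.

Lemma card_in_batch (m b n l : nat) : n = (m * b)%N -> (l < m)%N ->
  #|[pred j : 'I_n | in_batch b l j]| = b.
Proof.
move=> -> lm.
have H : (l * b + b <= m * b)%N by rewrite -mulSnr leq_mul2r lm orbT.
rewrite -sum1_card -[RHS](addKn (l * b)%N).
rewrite -[RHS]muln1 -sum_nat_const_nat (big_nat_widen _ _ _ _ _ H) big_geq_mkord.
by apply: eq_bigl => j; rewrite /in_batch !inE andbC.
Qed.

Lemma sum_batches (V : nmodType) (m b n : nat) (Y : nat -> 'I_n -> V) :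
  (0 < b)%N -> n = (m * b)%N ->
  \sum_(l < m) \sum_(j < n | in_batch b l j) Y l j = \sum_(j < n) Y (j %/ b)%N j.
Proof.
move=> b0 nE.
have H (j : 'I_n) : (j %/ b < m)%N by rewrite ltn_divLR // -nE.
rewrite [RHS](partition_big (fun j => Ordinal (H j)) xpredT) //=.
apply: eq_bigr => l _; apply: eq_big => [j|j]; first by rewrite in_batchE.
by rewrite in_batchE // => /eqP ->.
Qed.

Definition batch_mean (R : realType) (d n b : nat) (X : 'I_n -> 'rV[R]_d) (l : nat) :
  'rV[R]_d := b%:R^-1 *: \sum_(j < n | in_batch b l j) X j.

Lemma batch_mean_cst (R : realType) (d m n b l : nat) (x : 'rV[R]_d) :
  (0 < b)%N -> n = (m * b)%N -> (l < m)%N -> batch_mean b (fun _ : 'I_n => x) l = x.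
Proof.
move=> b0 nE lm; rewrite /batch_mean sumr_const (card_in_batch nE lm) -[x *+ b]scaler_nat scalerA.
by rewrite mulVf ?scale1r // pnatr_eq0 -lt0n.
Qed.

Lemma batch_meanD (R : realType) (d n b l : nat) (X Y : 'I_n -> 'rV[R]_d) :
  batch_mean b (fun j => X j + Y j) l = batch_mean b X l + batch_mean b Y l.
Proof. by rewrite /batch_mean big_split scalerDr. Qed.

Lemma normsq_batch_mean (R : realType) (d m n b l : nat) (X : 'I_n -> 'rV[R]_d) :
  (0 < b)%N -> n = (m * b)%N -> (l < m)%N ->
  normsq (batch_mean b X l) <= b%:R^-1 * \sum_(j < n | in_batch b l j) normsq (X j).
Proof.
move=> b0 nE lm; rewrite /batch_mean scaler_sumr.
apply: le_trans (normsq_sum_le _ _ _) _.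
rewrite sumr_const (card_in_batch nE lm).
suff -> : b%:R^-1 ^+ 2 *+ b = b%:R^-1 :> R by [].
by rewrite -[_ ^+ 2 *+ b]mulr_natr; field; rewrite pnatr_eq0 -lt0n.
Qed.

Lemma sum_batch_mean (R : realType) (d m n b : nat) (w : nat -> R) (X : 'I_n -> 'rV[R]_d) :
  (0 < b)%N -> n = (m * b)%N ->
  \sum_(l < m) w l *: batch_mean b X l = \sum_(j < n) (w (j %/ b)%N / b%:R) *: X j.
Proof.
move=> b0 nE.
rewrite -(sum_batches (fun l j => (w l / b%:R) *: X j) b0 nE).
by apply: eq_bigr => l _; rewrite /batch_mean scalerA scaler_sumr.
Qed.

(** Each batch contributes [b] terms [(w_l / b)^2]; this is the source of the factor [1 / b] for
    random permutations. *)
Lemma sum_batch_weight (R : realType) (m n b : nat) (w : nat -> R) :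
  (0 < b)%N -> n = (m * b)%N ->
  \sum_(j < n) (w (j %/ b)%N / b%:R) ^+ 2 = b%:R^-1 * \sum_(l < m) w l ^+ 2.
Proof.
move=> b0 nE.
rewrite -(sum_batches (fun l (j : 'I_n) => (w l / b%:R) ^+ 2) b0 nE) mulr_sumr.
apply: eq_bigr => l _; rewrite sumr_const (card_in_batch nE (ltn_ord l)).
by rewrite -[_ ^+ 2 *+ b]mulr_natr; field; rewrite pnatr_eq0 -lt0n.
Qed.

Lemma sum_perm (V : nmodType) (n : nat) (p : 'S_n) (X : 'I_n -> V) :
  \sum_j X (p j) = \sum_j X j.
Proof. by rewrite [RHS](reindex_inj (@perm_inj _ p)). Qed.

Lemma normsq_centered (R : realType) (d n : nat) (x : 'I_n -> 'rV[R]_d) : (0 < n)%N ->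
  let g := n%:R^-1 *: \sum_i x i in
  \sum_i (x i - g) = 0 /\ \sum_i normsq (x i - g) <= \sum_i normsq (x i).
Proof.
move=> n0 g.
have sx : \sum_i x i = n%:R *: g by rewrite /g scalerA divff ?scale1r // pnatr_eq0 -lt0n.
split; first by rewrite sumrB sumr_const card_ord sx scaler_nat subrr.
have -> : \sum_i normsq (x i - g) = \sum_i normsq (x i) - n%:R * normsq g.
  rewrite (eq_bigr (fun i => normsq (x i) - 2 * dotv (x i) g + normsq g)) => [|i _]; last first.
    by rewrite /normsq !(dotvDl, dotvDr, dotvNl, dotvNr) [dotv g (x i)]dotvC; ring.
  rewrite big_split sumrB /= -mulr_sumr -dotv_suml sx dotvZl -/(normsq g) sumr_const card_ord.
  by rewrite -[normsq g *+ n]mulr_natl; ring.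
by rewrite gerBl mulr_ge0 ?normsq_ge0.
Qed.

(* The covariances of sampling without replacement are nonpositive: for fixed [j] they do
   not depend on [k != j], and they add up to minus the variance because [a] is centered. *)
Lemma perm_cov_le0 (R : realType) (d n : nat) (a : 'I_n -> 'rV[R]_d) (j k : 'I_n) :
  \sum_i a i = 0 -> k != j -> \sum_(p : 'S_n) dotv (a (p j)) (a (p k)) <= 0.
Proof.
move=> a0 kj; pose E k := \sum_(p : 'S_n) dotv (a (p j)) (a (p k)).
have Ek k' : k' != j -> E k' = E k.
  move=> k'j; rewrite /E (reindex_inj (mulgI (tperm k k'))).
  by apply: eq_bigr => p _; rewrite !permM tpermR tpermD // eq_sym.
have : \sum_(k' | k' != j) E k' = - \sum_(p : 'S_n) normsq (a (p j)).
  rewrite exchange_big -sumrN; apply: eq_bigr => p _ /=.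
  rewrite -dotv_sumr; have /eqP := sum_perm p a.
  rewrite a0 (bigD1 j) //= addrC addr_eq0 => /eqP ->.
  by rewrite dotvNr.
rewrite (eq_bigr (fun _ => E k)) ?sumr_const; last by move=> k' /Ek.
move=> H; rewrite -(@pmulrn_lle0 _ _ #|[pred k' | k' != j]|); last first.
  by apply/card_gt0P; exists k.
by rewrite -/(E k) H oppr_le0; apply: sumr_ge0 => p _; exact: normsq_ge0.
Qed.

(** Composing with a transposition shows that the sum is the same for every position; summed over
    all positions, each permutation merely reorders [phi]. *)
Lemma perm_mean (R : realType) (n : nat) (phi : 'I_n -> R) (j : 'I_n) :
  \sum_(p : 'S_n) phi (p j) = #|{: 'S_n}|%:R * (n%:R^-1 * \sum_i phi i).
Proof.
have n0 : (0 < n)%N by case: (n) j => [[]|].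
have E k : \sum_(p : 'S_n) phi (p k) = \sum_(p : 'S_n) phi (p j).
  rewrite (reindex_inj (mulgI (tperm j k))).
  by apply: eq_bigr => p _; rewrite permM tpermR.
have : \sum_k \sum_(p : 'S_n) phi (p k) = #|{: 'S_n}|%:R * \sum_i phi i.
  rewrite exchange_big /= (eq_bigr (fun _ => \sum_i phi i)) => [|p _]; last exact: sum_perm.
  by rewrite sumr_const mulr_natl.
rewrite (eq_bigr _ (fun k _ => E k)) sumr_const card_ord -[_ *+ n]mulr_natl => H.
by rewrite mulrCA -H mulKf // pnatr_eq0 -lt0n.
Qed.

(** In the expanded square the off-diagonal terms are nonpositive covariances with nonnegative
    coefficients and are dropped; the diagonal gives the variance. *)
Lemma perm_sampling (R : realType) (d n : nat) (a : 'I_n -> 'rV[R]_d) (c : 'I_n -> R) :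
  (forall j, 0 <= c j) -> \sum_i a i = 0 ->
  \sum_(p : 'S_n) normsq (\sum_j c j *: a (p j)) <=
    #|{: 'S_n}|%:R * ((\sum_j c j ^+ 2) * (n%:R^-1 * \sum_i normsq (a i))).
Proof.
move=> c0 a0.
have -> : \sum_(p : 'S_n) normsq (\sum_j c j *: a (p j)) =
    \sum_j \sum_k c j * c k * \sum_(p : 'S_n) dotv (a (p j)) (a (p k)).
  under [RHS]eq_bigr do under eq_bigr do rewrite mulr_sumr.
  under [RHS]eq_bigr do rewrite exchange_big.
  rewrite [RHS]exchange_big; apply: eq_bigr => p _ /=.
  rewrite /normsq dotv_suml; apply: eq_bigr => j _.
  by rewrite dotv_sumr; apply: eq_bigr => k _; rewrite dotvZl dotvZr mulrA.
rewrite mulrCA mulr_suml; apply: ler_sum => j _.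
rewrite (bigD1 j) //= -[leRHS]addr0; apply: lerD.
  by rewrite expr2 (perm_mean (fun i => normsq (a i))).
by apply: sumr_le0 => k kj; rewrite mulr_ge0_le0 ?mulr_ge0 // perm_cov_le0.
Qed.


(** * Epochs of random reshuffling with momentum *)

Lemma sum_le_card (R : realType) (I : finType) (P : pred I) (f : I -> R) (x : R) :
  (forall i, P i -> f i <= x) -> \sum_(i | P i) f i <= #|P|%:R * x.
Proof. by move=> fx; rewrite mulr_natl -sumr_const; exact: ler_sum. Qed.

Lemma sum_le_combination (R : realType) (I : finType) (P : pred I) (f Q1 Q2 : I -> R)
  (x y c1 c2 : R) : (forall p, f p + x <= y + c1 * Q1 p + c2 * Q2 p) ->
  \sum_(p | P p) f p + #|P|%:R * x <=
    #|P|%:R * y + c1 * \sum_(p | P p) Q1 p + c2 * \sum_(p | P p) Q2 p.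
Proof.
move=> H; rewrite !mulr_natl -!sumr_const !mulr_sumr -!big_split /=.
by apply: ler_sum => p _; exact: H.
Qed.

Lemma mean_le (R : realType) (n : nat) (f : 'I_n -> R) (x : R) : (0 < n)%N ->
  (forall i, f i <= x) -> n%:R^-1 * \sum_i f i <= x.
Proof.
move=> n0 fx; rewrite mulrC ler_pdivrMr ?ltr0n // mulrC.
by have := sum_le_card (P := xpredT) (fun i _ => fx i); rewrite card_ord.
Qed.

Lemma normsq_gavgB (R : realType) (d n : nat) (G : 'I_n -> 'rV[R]_d -> 'rV[R]_d) (L : R) :
  (0 < n)%N -> (forall i x y, normsq (G i x - G i y) <= L ^+ 2 * normsq (x - y)) ->
  forall x y, normsq (gavg G x - gavg G y) <= L ^+ 2 * normsq (x - y).
Proof.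
move=> n0 LG x y; rewrite /gavg -scalerBr -sumrB scaler_sumr.
apply: le_trans (normsq_sum_le _ _ _) _.
rewrite sumr_const card_ord.
have -> : n%:R^-1 ^+ 2 *+ n = n%:R^-1 :> R.
  by rewrite -[_ ^+ 2 *+ n]mulr_natr; field; rewrite pnatr_eq0 -lt0n.
exact: mean_le.
Qed.

Lemma favg_descent (R : realType) (d n : nat) (F : 'I_n -> 'rV[R]_d -> R)
  (G : 'I_n -> 'rV[R]_d -> 'rV[R]_d) (L : R) : (0 < n)%N ->
  (forall i x h, F i (x + h) <= F i x + dotv (G i x) h + L / 2 * normsq h) ->
  forall x h, favg F (x + h) <= favg F x + dotv (gavg G x) h + L / 2 * normsq h.
Proof.
move=> n0 desc x h; have N0 : 0 < n%:R :> R by rewrite ltr0n.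
rewrite /favg /gavg dotvZl dotv_suml -lerBlDl -mulrDr -mulrBr -big_split -sumrB /=.
by apply: mean_le => // i; have := desc i x h; lra.
Qed.

Lemma favg_ge (R : realType) (d n : nat) (F : 'I_n -> 'rV[R]_d -> R) (fbar : R) :
  (0 < n)%N -> (forall i x, fbar <= F i x) -> forall x, fbar <= favg F x.
Proof.
move=> n0 Fb x; rewrite -lerN2 /favg -mulrN -sumrN.
by apply: mean_le => // i; rewrite lerN2.
Qed.

Definition shadow (R : realType) (d : nat) (beta : R) (st : 'rV[R]_d * 'rV[R]_d) :
  'rV[R]_d := st.2 + (beta / (1 - beta)) *: (st.2 - st.1).

Definition lyapunov (R : realType) (d n : nat) (F : 'I_n -> 'rV[R]_d -> R)
  (fbar beta mu : R) (st : 'rV[R]_d * 'rV[R]_d) : R :=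
  favg F (shadow beta st) - fbar + mu * normsq (st.2 - st.1).

Lemma lyapunov_ge0 (R : realType) (d n : nat) (F : 'I_n -> 'rV[R]_d -> R)
  (fbar beta mu : R) (st : 'rV[R]_d * 'rV[R]_d) :
  (0 < n)%N -> (forall i x, fbar <= F i x) -> 0 <= mu -> 0 <= lyapunov F fbar beta mu st.
Proof.
by move=> n0 Fb mu0; rewrite addr_ge0 ?mulr_ge0 ?normsq_ge0 // subr_ge0 favg_ge.
Qed.

Lemma lyapunov_le (R : realType) (d n : nat) (F : 'I_n -> 'rV[R]_d -> R)
  (fbar beta mu mu' : R) (st : 'rV[R]_d * 'rV[R]_d) : mu <= mu' ->
  lyapunov F fbar beta mu st <= lyapunov F fbar beta mu' st.
Proof. by move=> H; rewrite /lyapunov lerD2l ler_wpM2r ?normsq_ge0. Qed.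

(** Evaluation at one point [z], fixed for the epoch, makes the dependence on [p] pure sampling
    without replacement. *)
Definition noise (R : realType) (d n : nat) (G : 'I_n -> 'rV[R]_d -> 'rV[R]_d) (b : nat)
  (p : 'S_n) (z : 'rV[R]_d) (l : nat) : 'rV[R]_d :=
  batch_mean b (fun j => G (p j) z - gavg G z) l.

Lemma rrm_epoch_descent (R : realType) (d m b n : nat) (F : 'I_n -> 'rV[R]_d -> R)
  (G : 'I_n -> 'rV[R]_d -> 'rV[R]_d) (L fbar beta lam h mu : R) (p : 'S_n)
  (st : 'rV[R]_d * 'rV[R]_d) :
  (0 < m)%N -> (0 < b)%N -> n = (m * b)%N -> 0 < L ->
  (forall i x h, F i (x + h) <= F i x + dotv (G i x) h + L / 2 * normsq h) ->
  (forall i x y, normsq (G i x - G i y) <= L ^+ 2 * normsq (x - y)) ->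
  0 <= beta -> beta < 1 -> 0 <= lam -> lam <= beta / (1 - beta) ->
  0 < h -> 4 * (L * h * m%:R) <= 1 - beta ^+ m ->
  mu = 2 * (h * m%:R) * L ^+ 2 * (beta / (1 - beta)) ^+ 2 / (1 - beta ^+ m) ->
  lyapunov F fbar beta mu (rrm_epoch G m b p (h * (1 - beta)) beta lam st)
    + h * m%:R / 16 * normsq (gavg G st.2) <=
  lyapunov F fbar beta mu st
    + 11 / 3 * L ^+ 2 * h ^+ 3 *
      \sum_(i < m) normsq (\sum_(l < i)
         drift_weight (beta / (1 - beta) - lam) beta i l *: noise G b p (shadow beta st) l)
    + 4 * m%:R * L ^+ 2 * h ^+ 3 / (1 - beta ^+ m) ^+ 2 *
      normsq (\sum_(l < m) beta ^+ (m - l.+1) *: noise G b p (shadow beta st) l).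
Proof.
move=> m0 b0 nE L0 desc LG be0 be1 lam0 lamB h0 hu muE.
have n0 : (0 < n)%N by rewrite nE muln_gt0 m0.
have ob : 1 - beta != 0 by rewrite gt_eqF // subr_gt0.
set B := beta / (1 - beta) in lamB muE *.
have HB : B * (1 - beta) = beta by rewrite /B divfK.
pose s i := iteri i (rrm_inner G b p (h * (1 - beta)) beta lam) st.
pose v i := (s i).2 - (s i).1.
pose z i := shadow beta (s i).
pose yh i := (s i).2 + lam *: v i.
pose D i := batch_mean b (fun j => G (p j) (yh i)) i.
have sS i : s i.+1 = ((s i).2, (s i).2 - (h * (1 - beta)) *: D i + beta *: v i).
  by rewrite /s /= -/(s i) /rrm_inner /D /yh /v; case: (s i).
have vS i : v i.+1 = beta *: v i - (h * (1 - beta)) *: D i.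
  by rewrite {1}/v sS /=; apply/rowP => j; rewrite !mxE; ring.
have zS i : z i.+1 = z i - h *: D i.
  rewrite /z /shadow -/B -/(v i.+1) -/(v i) vS sS /=.
  apply/rowP => j; rewrite !mxE.
  by rewrite /B; field; rewrite ob pnatr_eq0 -lt0n b0.
(* The shadow iterate is [y + B v] and the gradients are taken at [y + lam v]; their difference is
   [c v]. *)
pose c := B - lam.
have yhE i : z i - c *: v i = yh i.
  by rewrite /z /yh /shadow -/B -/(v i) /c; apply/rowP => j; rewrite !mxE; ring.
pose e l := batch_mean b (fun j => G (p j) (yh l) - G (p j) (z 0%N)) l.
have Dl l : (l < m)%N -> D l = gavg G (z 0%N) + noise G b p (z 0%N) l + e l.
  move=> lm; rewrite -[gavg G (z 0%N)](batch_mean_cst _ b0 nE lm) /noise -!batch_meanD.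
  rewrite /D /batch_mean; congr (_ *: _); apply: eq_bigr => j _.
  by rewrite [gavg _ _ + _]addrC subrK [RHS]addrC subrK.
have el l : (l < m)%N -> normsq (e l) <= L ^+ 2 * normsq (z l - c *: v l - z 0%N).
  move=> lm; apply: le_trans (normsq_batch_mean _ b0 nE lm) _; rewrite yhE.
  rewrite mulrC ler_pdivrMr ?ltr0n // [leRHS]mulrC.
  by rewrite -[X in X%:R * _](card_in_batch nE lm); apply: sum_le_card => j _; exact: LG.
(* The mini-batches partition all positions, and a permutation does not change the sum of the
   centered gradients. *)
have noise0 : \sum_(l < m) noise G b p (z 0%N) l = 0.
  rewrite -[LHS]scale1r scaler_sumr.
  rewrite (sum_batch_mean (fun=> 1) (fun j => G (p j) (z 0%N) - gavg G (z 0%N)) b0 nE).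
  rewrite -scaler_sumr; have /= -> := sum_perm p (fun i => G i (z 0%N) - gavg G (z 0%N)).
  by rewrite (normsq_centered (fun i => G i (z 0%N)) n0).1 scaler0.
have Hf : favg F (z m) - fbar <= favg F (z 0%N) - fbar + dotv (gavg G (z 0%N)) (z m - z 0%N)
    + L / 2 * normsq (z m - z 0%N).
  have := favg_descent n0 desc (z 0%N) (z m - z 0%N); rewrite [z 0%N + _]addrC subrK.
  by lra.
have HN : normsq (gavg G st.2) <=
    2 * normsq (gavg G (z 0%N)) + 2 * L ^+ 2 * B ^+ 2 * normsq (v 0%N).
  have := normsqD2 (gavg G (z 0%N)) (gavg G st.2 - gavg G (z 0%N)).
  rewrite [gavg G (z 0%N) + _]addrC subrK.
  have := normsq_gavgB n0 LG st.2 (z 0%N).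
  have -> : st.2 - z 0%N = - B *: v 0%N.
    by rewrite /z /shadow opprD addrA subrr add0r scaleNr.
  by rewrite normsqZ sqrrN; lra.
have c0 : 0 <= c by rewrite subr_ge0.
have cB : c <= B by rewrite /c gerBl.
have := epoch_descent m0 be0 be1 h0 L0 HB c0 cB hu vS zS Dl el noise0 Hf HN erefl muE.
by rewrite /lyapunov addrAC.
Qed.

(** In units of [(L h)^3 M^2 kappa gap] the two noise terms are [11/3] and [8 / rho^2]. As
    [rho <= 1], they add up to at most [35/3 / rho^2], which is [7/6] of [10 / rho^2]. *)
Lemma noise_weight_arith (R : realType) (M h L rho kappa gap s1 s2 : R) :
  0 < M -> 0 < h -> 0 < L -> 0 < rho -> rho <= 1 -> 0 <= kappa -> 0 <= gap ->
  s1 <= M ^+ 2 / 2 * (kappa * (2 * L * gap)) -> s2 <= M * (kappa * (2 * L * gap)) ->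
  11 / 3 * L ^+ 2 * h ^+ 3 * s1 + 4 * M * L ^+ 2 * h ^+ 3 / rho ^+ 2 * s2 <=
    7 / 6 * (10 / rho ^+ 2 * (L * h) ^+ 3 * M ^+ 2 * kappa) * gap.
Proof.
move=> M0 h0 L0 r0 r1 k0 g0 H1 H2.
have q1 : 0 <= 11 / 3 * L ^+ 2 * h ^+ 3 by rewrite !mulr_ge0 ?invr_ge0 // ?exprn_ge0 // ltW.
have q2 : 0 <= 4 * M * L ^+ 2 * h ^+ 3 / rho ^+ 2.
  by rewrite divr_ge0 ?exprn_ge0 ?mulr_ge0 ?exprn_ge0 // ltW.
have := lerD (ler_wpM2l q1 H1) (ler_wpM2l q2 H2).
move=> /le_trans; apply.
have r2 : 1 <= (rho ^+ 2)^-1.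
  by rewrite invf_ge1 ?exprn_gt0 // exprn_ile1 // ltW.
have q3 : 0 <= L ^+ 3 * h ^+ 3 * M ^+ 2 * kappa * gap.
  by rewrite !mulr_ge0 // ?exprn_ge0 // ltW.
by have := ler_wpM2l q3 r2; lra.
Qed.

(** The predicate [P] treats both cases at once: a singleton for a given permutation, everything for
    the uniform mean. The noise hypothesis covers all [k <= m] because the drift at step [i]
    involves the first [i] mini-batches. *)
Lemma rrm_epoch_mean (R : realType) (d m b n : nat) (F : 'I_n -> 'rV[R]_d -> R)
  (G : 'I_n -> 'rV[R]_d -> 'rV[R]_d) (L fbar beta lam h mu kappa : R) (P : pred 'S_n)
  (st : 'rV[R]_d * 'rV[R]_d) :
  (0 < m)%N -> (0 < b)%N -> n = (m * b)%N -> 0 < L ->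
  (forall i x h, F i (x + h) <= F i x + dotv (G i x) h + L / 2 * normsq h) ->
  (forall i x y, normsq (G i x - G i y) <= L ^+ 2 * normsq (x - y)) ->
  (forall i x, fbar <= F i x) ->
  0 <= beta -> beta < 1 -> 0 <= lam -> lam <= beta / (1 - beta) ->
  0 < h -> 4 * (L * h * m%:R) <= 1 - beta ^+ m ->
  mu = 2 * (h * m%:R) * L ^+ 2 * (beta / (1 - beta)) ^+ 2 / (1 - beta ^+ m) ->
  0 <= kappa ->
  (forall (a : 'I_n -> 'rV[R]_d) (w : nat -> R) (k : nat), \sum_i a i = 0 ->
     (forall l, 0 <= w l <= 1) -> (k <= m)%N ->
     \sum_(p | P p) normsq (\sum_(l < k) w l *: batch_mean b (fun j => a (p j)) l)
       <= #|P|%:R * (k%:R * (kappa * (n%:R^-1 * \sum_i normsq (a i))))) ->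
  \sum_(p | P p) lyapunov F fbar beta mu (rrm_epoch G m b p (h * (1 - beta)) beta lam st)
    + #|P|%:R * (h * m%:R / 16 * normsq (gavg G st.2)) <=
  #|P|%:R * ((1 + 7 / 6 * (10 / (1 - beta ^+ m) ^+ 2 * (L * h) ^+ 3 * m%:R ^+ 2 * kappa))
     * lyapunov F fbar beta mu st).
Proof.
move=> m0 b0 nE L0 desc LG Fb be0 be1 lam0 lamB h0 hu muE k0 HP.
have n0 : (0 < n)%N by rewrite nE muln_gt0 m0.
have N0 : 0 < n%:R :> R by rewrite ltr0n.
have M0 : 0 < m%:R :> R by rewrite ltr0n.
have ob : 0 < 1 - beta by rewrite subr_gt0.
have rho0 : 0 < 1 - beta ^+ m by rewrite subr_gt0 exprn_ilt1 // -lt0n.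
have rho1 : 1 - beta ^+ m <= 1 by rewrite gerBl exprn_ge0.
have mu0 : 0 <= mu.
  by rewrite muE !mulr_ge0 ?invr_ge0 // ltW.
set z := shadow beta st; set gap := favg F z - fbar.
pose a i := G i z - gavg G z.
have [a0 aV] := normsq_centered (fun i => G i z) n0.
(* The variance is at most the second moment, and the gap bounds each component gradient separately,
   with the common lower bound [fbar]. *)
have gapV : n%:R^-1 * \sum_i normsq (a i) <= 2 * L * gap.
  apply: le_trans (_ : n%:R^-1 * \sum_i normsq (G i z) <= _).
    by rewrite ler_pM2l ?invr_gt0.
  rewrite -subr_le0 /gap.
  have -> : n%:R^-1 * \sum_i normsq (G i z) - 2 * L * (favg F z - fbar) =
      n%:R^-1 * \sum_i (normsq (G i z) - 2 * L * (F i z - fbar)).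
    rewrite sumrB -mulr_sumr sumrB sumr_const card_ord -[fbar *+ n]mulr_natr /favg.
    by field; rewrite gt_eqF.
  by apply: mean_le => // i; rewrite subr_le0; apply: gradient_le_gap => //; exact: desc.
have gap0 : 0 <= gap by rewrite subr_ge0; exact: favg_ge.
have gap_le : gap <= lyapunov F fbar beta mu st.
  by rewrite /lyapunov -/z -/gap lerDl mulr_ge0 // normsq_ge0.
have K0 : 0 <= #|P|%:R :> R by exact: ler0n.
have HP' (w : nat -> R) k : (forall l, 0 <= w l <= 1) -> (k <= m)%N ->
    \sum_(p | P p) normsq (\sum_(l < k) w l *: noise G b p z l)
      <= #|P|%:R * (k%:R * (kappa * (2 * L * gap))).
  move=> w01 km; apply: le_trans (HP a w k a0 w01 km) _.
  by rewrite !ler_wpM2l.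
have c01 i l : 0 <= drift_weight (beta / (1 - beta) - lam) beta i l <= 1.
  apply: drift_weight_itv => //; first by rewrite subr_ge0.
  rewrite mulrBl divfK ?gt_eqF //.
  have := mulr_ge0 lam0 (ltW ob); lra.
have := sum_le_combination P (fun p =>
  rrm_epoch_descent fbar p st m0 b0 nE L0 desc LG be0 be1 lam0 lamB h0 hu muE).
move=> /le_trans; apply; rewrite -/z exchange_big /=.
have K0g : 0 <= #|P|%:R * gap by exact: mulr_ge0.
have := @noise_weight_arith _ m%:R h L (1 - beta ^+ m) kappa (#|P|%:R * gap)
  (\sum_(i < m) \sum_(p | P p) normsq (\sum_(l < i)
     drift_weight (beta / (1 - beta) - lam) beta i l *: noise G b p z l))
  (\sum_(p | P p) normsq (\sum_(l < m) beta ^+ (m - l.+1) *: noise G b p z l))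
  M0 h0 L0 rho0 rho1 k0 K0g.
set c1 := 11 / 3 * L ^+ 2 * h ^+ 3; set c2 := 4 * _ * _ * _ / _.
set t := 10 / _ * _ * _ * _; move=> H.
have t0 : 0 <= t.
  by rewrite /t !mulr_ge0 // ?invr_ge0 ?exprn_ge0 ?mulr_ge0 // ltW.
lapply H; last first.
  apply: le_trans (_ : \sum_(i < m) #|P|%:R * (i%:R * (kappa * (2 * L * gap))) <= _).
    by apply: ler_sum => i _; apply: HP' => //; exact: ltnW.
  rewrite -mulr_sumr -mulr_suml.
  have -> : m%:R ^+ 2 / 2 * (kappa * (2 * L * (#|P|%:R * gap))) =
    #|P|%:R * (m%:R ^+ 2 / 2 * (kappa * (2 * L * gap))) by ring.
  rewrite ler_wpM2l // ler_wpM2r ?sum_ord_le_half_sqr //.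
  by rewrite !mulr_ge0 // ltW.
move=> {}H; lapply H; last first.
  have -> : m%:R * (kappa * (2 * L * (#|P|%:R * gap))) =
    #|P|%:R * (m%:R * (kappa * (2 * L * gap))) by ring.
  apply: (HP' (fun l => beta ^+ (m - l.+1))) => // l.
  by rewrite exprn_ge0 //= exprn_ile1 // ltW.
have : 7 / 6 * t * (#|P|%:R * gap) <= 7 / 6 * t * (#|P|%:R * lyapunov F fbar beta mu st).
  rewrite ler_wpM2l ?ler_wpM2l //.
  by rewrite mulr_ge0 // divr_ge0.
by lra.
Qed.


(** Cauchy-Schwarz over the batches and again inside each batch leaves [k / b] times the sum of the
    squares; since [1 / b = m / n], this is [kappa = m]. *)
Lemma noise_bound_pred1 (R : realType) (d m b n : nat) (p : 'S_n) :
  (0 < b)%N -> n = (m * b)%N -> (0 < m)%N ->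
  forall (a : 'I_n -> 'rV[R]_d) (w : nat -> R) (k : nat), \sum_i a i = 0 ->
     (forall l, 0 <= w l <= 1) -> (k <= m)%N ->
     \sum_(q | pred1 p q) normsq (\sum_(l < k) w l *: batch_mean b (fun j => a (q j)) l)
       <= #|pred1 p|%:R * (k%:R * (m%:R * (n%:R^-1 * \sum_i normsq (a i)))).
Proof.
move=> b0 nE m0 a w k _ w01 km; rewrite big_pred1_eq card1 mul1r.
apply: le_trans (normsq_sum_le _ _ _) _.
apply: ler_pM; first by apply: sumr_ge0 => *; exact: sqr_ge0.
- by apply: sumr_ge0 => *; exact: normsq_ge0.
- exact: (sum_sqr_itv (fun l : 'I_k => w01 l)).
rewrite (big_ord_widen _ (fun l => normsq (batch_mean b (fun j => a (p j)) l)) km).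
apply: le_trans (_ : \sum_(l < m) normsq (batch_mean b (fun j => a (p j)) l) <= _).
  by rewrite big_mkcond; apply: ler_sum => l _; case: ifP => // _; exact: normsq_ge0.
apply: le_trans (ler_sum _ (fun l _ => normsq_batch_mean _ b0 nE (ltn_ord l))) _.
rewrite -mulr_sumr (sum_batches (fun _ j => normsq (a (p j))) b0 nE).
have /= -> := sum_perm p (fun i => normsq (a i)).
have B0 : b%:R != 0 :> R by rewrite pnatr_eq0 -lt0n.
have M0 : m%:R != 0 :> R by rewrite pnatr_eq0 -lt0n.
rewrite mulrA (_ : b%:R^-1 = m%:R * n%:R^-1) //.
by rewrite nE natrM; field; rewrite B0 M0.
Qed.

Lemma noise_bound_uniform (R : realType) (d m b n : nat) :
  (0 < b)%N -> n = (m * b)%N ->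
  forall (a : 'I_n -> 'rV[R]_d) (w : nat -> R) (k : nat), \sum_i a i = 0 ->
     (forall l, 0 <= w l <= 1) -> (k <= m)%N ->
     \sum_(p : 'S_n | predT p) normsq (\sum_(l < k) w l *: batch_mean b (fun j => a (p j)) l)
       <= #|(predT : pred 'S_n)|%:R * (k%:R * (b%:R^-1 * (n%:R^-1 * \sum_i normsq (a i)))).
Proof.
move=> b0 nE a w k a0 w01 km.
(* Zero weights on the batches from [k] on turn the partial sum into a sum over all positions, as
   the sampling bound requires. *)
pose w' l := if (l < k)%N then w l else 0.
have w'0 l : 0 <= w' l by rewrite /w'; case: ifP => // _; case/andP: (w01 l).
have E (p : 'S_n) : \sum_(l < k) w l *: batch_mean b (fun j => a (p j)) l =
    \sum_(j < n) (w' (j %/ b)%N / b%:R) *: a (p j).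
  rewrite -(sum_batch_mean w' (fun j => a (p j)) b0 nE).
  rewrite (big_ord_widen _ (fun l => w l *: batch_mean b (fun j => a (p j)) l) km) big_mkcond.
  by apply: eq_bigr => l _; rewrite /w'; case: ifP => // _; rewrite scale0r.
under eq_bigr do rewrite E.
apply: le_trans (perm_sampling _ a0) _ => [j|].
  by rewrite divr_ge0.
rewrite ler_wpM2l // (sum_batch_weight _ b0 nE).
rewrite [leRHS]mulrCA -[leLHS]mulrA ler_wpM2l ?invr_ge0 //.
rewrite ler_wpM2r ?mulr_ge0 ?invr_ge0 ?sumr_ge0 // => [i _|]; first exact: normsq_ge0.
have -> : \sum_(l < m) w' l ^+ 2 = \sum_(l < k) w l ^+ 2.
  rewrite (big_ord_widen _ (fun l => w l ^+ 2) km) [RHS]big_mkcond.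
  by apply: eq_bigr => l _; rewrite /w'; case: ifP => // _; rewrite expr0n.
exact: (sum_sqr_itv (fun l : 'I_k => w01 l)).
Qed.

(** * From the recursion to the rate *)

(* [phi tau = 1 + 7/6 tau + 11/6 tau^2] satisfies [7/6 phi <= phi'] on [[0, 1]], so it
   majorizes the products of the growth factors [1 + 7/6 t k]; and [phi tau <= 1 + 3 tau]. *)
Lemma recursion_sum_le (R : realType) (M N q t : nat -> R) (T : nat) :
  (forall k, (1 <= k)%N -> 0 <= M k) -> (forall k, 0 <= N k) ->
  (forall k, (1 <= k)%N -> 0 <= q k) -> (forall k, (1 <= k)%N -> 0 <= t k) ->
  (forall k, (1 <= k <= T)%N -> M k.+1 + q k * N k <= (1 + 7 / 6 * t k) * M k) ->
  \sum_(1 <= k < T.+1) t k <= 1 ->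
  \sum_(1 <= k < T.+1) q k * N k <= (1 + 3 * \sum_(1 <= k < T.+1) t k) * M 1%N.
Proof.
move=> M0 N0 q0 t0 rec tau1.
pose tau K := \sum_(1 <= k < K.+1) t k.
pose S K := \sum_(1 <= k < K.+1) q k * N k.
have tau0 K : 0 <= tau K.
  by rewrite /tau big_nat; apply: sumr_ge0 => k /andP[k1 _]; exact: t0.
have S0 K : 0 <= S K.
  by rewrite /S big_nat; apply: sumr_ge0 => k /andP[k1 _]; rewrite mulr_ge0 // q0.
have tauS K : tau K.+1 = tau K + t K.+1 by rewrite /tau big_nat_recr.
have SS K : S K.+1 = S K + q K.+1 * N K.+1 by rewrite /S big_nat_recr.
(* Keeping [S K] on the left makes the invariant inductive; as [S K >= 0], it also bounds [M K.+1]
   alone. *)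
have main K : (K <= T)%N -> tau K <= 1 /\
    S K + M K.+1 <= (1 + 7 / 6 * tau K + 11 / 6 * tau K ^+ 2) * M 1%N.
  move=> KT; have tK : tau K <= 1.
    apply: le_trans tau1; rewrite /tau [leRHS](big_cat_nat (n := K.+1)) //=.
    by rewrite lerDl big_nat; apply: sumr_ge0 => k /andP[k1 _]; apply: t0; exact: leq_trans k1.
  split=> //; elim: K KT tK => [|K IH] KT tK.
    by rewrite /S /tau !big_geq // expr0n /=; lra.
  have tK' : tau K <= 1 by apply: le_trans tK; rewrite tauS lerDl t0.
  have {}IH := IH (ltnW KT) tK'.
  have := rec K.+1 KT; rewrite SS tauS.
  have := S0 K; have tp := t0 K.+1 isT.
  move: IH (M0 1%N isT) (tau0 K) tK' tp.
  move: (t K.+1) (q K.+1 * N K.+1) (M K.+1) (M K.+2) (M 1%N) (S K) (tau K).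
  move=> u x y y' A s r IH A0 r0 r1 u0 s0 Hrec.
  have yA : y <= (1 + 7 / 6 * r + 11 / 6 * r ^+ 2) * A by lra.
  have := ler_wpM2l u0 yA.
  have uA : 0 <= u * A by exact: mulr_ge0.
  have : 0 <= u * A * (1 - r) by rewrite mulr_ge0 // subr_ge0.
  have : 0 <= u * A * r by rewrite mulr_ge0.
  have : 0 <= u * A * (r * (1 - r)) by rewrite !mulr_ge0 // subr_ge0.
  have : 0 <= u * A * u by rewrite mulr_ge0.
  by lra.
have [tT ST] := main T (leqnn T).
have := M0 T.+1 isT; have Tr : 0 <= tau T * (1 - tau T) * M 1%N.
  by rewrite !mulr_ge0 ?subr_ge0 ?M0.
by rewrite -/(S T) -/(tau T); lra.
Qed.

(** The minimum is at most the mean of the [N k] with weights proportional to [alpha k]. The default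
    [x] is arbitrary, since it can only lower the minimum. *)
Lemma rate_of_recursion (R : realType) (M N alpha : nat -> R) (T m : nat) (beta C x : R) :
  (0 < m)%N -> (1 <= T)%N -> beta < 1 -> 0 <= C ->
  (forall k, (1 <= k)%N -> 0 <= M k) -> (forall k, 0 <= N k) ->
  (forall k, (1 <= k)%N -> 0 < alpha k) ->
  (forall k, (1 <= k <= T)%N ->
     M k.+1 + alpha k / (1 - beta) * m%:R / 16 * N k <=
       (1 + 7 / 6 * (C * alpha k ^+ 3)) * M k) ->
  C * \sum_(1 <= k < T.+1) alpha k ^+ 3 <= 1 ->
  \big[Num.min/x]_(1 <= k < T.+1) N k <=
    (1 + 3 * (C * \sum_(1 <= k < T.+1) alpha k ^+ 3)) / (m%:R * \sum_(1 <= k < T.+1) alpha k)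
     * (16 * (1 - beta) * M 1%N).
Proof.
move=> m0 T0 b1 C0 M0 N0 al0 rec CS.
have ob : 0 < 1 - beta by rewrite subr_gt0.
have mp : 0 < m%:R :> R by rewrite ltr0n.
set mn := \big[_/_]_(_ <= _ < _) _.
pose q k := alpha k / (1 - beta) * m%:R / 16.
have q0 k : (1 <= k)%N -> 0 <= q k.
  by move=> k1; rewrite /q !mulr_ge0 ?invr_ge0 // ltW // al0.
have t0 k : (1 <= k)%N -> 0 <= C * alpha k ^+ 3.
  by move=> k1; rewrite mulr_ge0 // exprn_ge0 // ltW // al0.
rewrite mulr_sumr in CS *.
have H := recursion_sum_le M0 N0 q0 t0 rec CS.
have S1 : 0 < \sum_(1 <= k < T.+1) alpha k.
  rewrite big_nat_recl // -[ltLHS]addr0; apply: ltr_leD; first exact: al0.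
  by rewrite big_nat; apply: sumr_ge0 => k _; rewrite ltW // al0.
have H2 : m%:R * (\sum_(1 <= k < T.+1) alpha k) / (16 * (1 - beta)) * mn <=
    \sum_(1 <= k < T.+1) q k * N k.
  rewrite mulr_sumr !mulr_suml !big_nat; apply: ler_sum => k kT.
  have -> : m%:R * alpha k / (16 * (1 - beta)) = q k by rewrite /q; field; rewrite gt_eqF.
  by rewrite ler_wpM2l ?q0 //; [case/andP: kT | apply: ge_bigmin_seq; rewrite ?mem_index_iota].
have p0 : 0 < m%:R * (\sum_(1 <= k < T.+1) alpha k) / (16 * (1 - beta)).
  by rewrite divr_gt0 ?mulr_gt0.
rewrite -(ler_pM2l p0); apply: le_trans H2 _; apply: le_trans H _.
rewrite le_eqVlt; apply/orP; left; apply/eqP; field.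
by rewrite !gt_eqF.
Qed.

(** * Redrawing one permutation of a uniform tuple *)

Definition resample (T n : nat) (P : {ffun 'I_T -> 'S_n}) (i : 'I_T) (q : 'S_n) :
  {ffun 'I_T -> 'S_n} := [ffun j => if j == i then q else P j].

(** Redrawing one coordinate preserves the uniform law: with the new value written as [P i * q], the
    change of [P] is, for fixed [q], a bijection undone by the inverse of [q]. *)
Lemma sum_resample (R : realType) (T n : nat) (i : 'I_T) (f : {ffun 'I_T -> 'S_n} -> R) :
  \sum_P \sum_q f (resample P i q) = #|{: 'S_n}|%:R * \sum_P f P.
Proof.
pose shift (q : 'S_n) (P : {ffun 'I_T -> 'S_n}) := resample P i (P i * q)%g.
have shiftK q : cancel (shift q) (shift q^-1%g).
  move=> P; apply/ffunP => j; rewrite !ffunE eqxx mulgK.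
  by case: eqP => // ->.
transitivity (\sum_P \sum_q f (shift q P)).
  by apply: eq_bigr => P _; rewrite (reindex_inj (mulgI (P i))).
rewrite exchange_big /= (eq_bigr (fun _ => \sum_P f P)) => [|q _].
  by rewrite sumr_const mulr_natl.
by rewrite [RHS](reindex_inj (can_inj (shiftK q))).
Qed.

Lemma rrm_st_ext (R : realType) (d n m b : nat) (G : 'I_n -> 'rV[R]_d -> 'rV[R]_d)
  (pi pi' : nat -> 'S_n) (alpha : nat -> R) (beta lam : R) (x1 : 'rV[R]_d) (k : nat) :
  (forall j, (1 <= j <= k)%N -> pi j = pi' j) ->
  rrm_st G m b pi alpha beta lam x1 k = rrm_st G m b pi' alpha beta lam x1 k.
Proof.
elim: k => [//|k IH] H /=; rewrite IH ?H ?leqnn // => j /andP[j1 jk].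
by rewrite H // j1 leqW.
Qed.

(** Coordinate [i] counts from 0 and drives epoch [i.+1], so redrawing it does not affect the state
    before that epoch. This expresses the independence of a state and the next permutation. *)
Lemma rrm_st_resample (R : realType) (d n m b T : nat) (G : 'I_n -> 'rV[R]_d -> 'rV[R]_d)
  (alpha : nat -> R) (beta lam : R) (x1 : 'rV[R]_d) (P : {ffun 'I_T -> 'S_n})
  (i : 'I_T) (q : 'S_n) :
  rrm_st G m b (perm_seq (resample P i q)) alpha beta lam x1 i.+1 =
  rrm_epoch G m b q (alpha i.+1) beta lam (rrm_st G m b (perm_seq P) alpha beta lam x1 i).
Proof.
have qE : perm_seq (resample P i q) i.+1 = q by rewrite /perm_seq /= valK ffunE eqxx.
rewrite [LHS]/rrm_st -/rrm_st qE; congr (rrm_epoch _ _ _ _ _ _ _).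
apply: rrm_st_ext => j /andP[j1 ji]; rewrite /perm_seq.
case: insubP => // l _ lE; rewrite ffunE ifN //.
by apply/eqP => li; move: ji; rewrite -li lE; case: j j1 {lE} => // j _; rewrite ltnn.
Qed.

Theorem theorem4p1 (R : realType) (d n m b : nat)
  (F : 'I_n -> 'rV[R]_d -> R) (G : 'I_n -> 'rV[R]_d -> 'rV[R]_d)
  (L fbar beta lam : R) (alpha : nat -> R) (x1 : 'rV[R]_d) (T : nat) :
  (0 < m)%N -> (0 < b)%N -> n = (m * b)%N ->
  (* f_i continuously differentiable with gradient G i *)
  (forall i x, differentiable (F i) x) ->
  (forall i x h, 'd (F i) x h = dotv (G i x) h) ->
  (forall i, continuous (G i)) ->
  (* (A.a) *)
  0 < L ->
  (forall i x y, enorm (G i x - G i y) <= L * enorm (x - y)) ->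
  (forall i x, fbar <= F i x) ->
  (* (A.b) *)
  (forall k, (1 <= k)%N -> alpha k.+1 <= alpha k) ->
  0 <= beta -> beta < 1 ->
  0 <= lam -> lam <= beta / (1 - beta) ->
  (forall k, (1 <= k)%N ->
     0 < alpha k /\ alpha k <= (1 - beta) * (1 - beta ^+ m) / (4 * L * m%:R)) ->
  (1 <= T)%N ->
  let D := 10 / (1 - beta ^+ m) ^+ 2 * (L / (1 - beta)) ^+ 3 in
  let S3 := \sum_(1 <= k < T.+1) alpha k ^+ 3 in
  let S1 := \sum_(1 <= k < T.+1) alpha k in
  let gn2 := fun pi k =>
    enorm (gavg G (rrm_x G m b pi alpha beta lam x1 k)) ^+ 2 in
  (* (a) arbitrary permutations *)
  (S3 <= (D * m%:R ^+ 3)^-1 ->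
   forall pi : nat -> 'S_n,
     \big[Num.min/gn2 pi 1%N]_(1 <= k < T.+1) gn2 pi k
     <= (1 + 3 * D * m%:R ^+ 3 * S3) / (m%:R * S1)
        * (16 * (1 - beta) * (favg F x1 - fbar)))
  /\
  (* (b) (A.c): independent uniformly random permutations *)
  (S3 <= b%:R / (D * m%:R ^+ 2) ->
     \big[Num.min/Eperm T (fun pi => gn2 pi 1%N)]_(1 <= k < T.+1)
        Eperm T (fun pi => gn2 pi k)
     <= (1 + 3 * D * m%:R ^+ 2 * b%:R^-1 * S3) / (m%:R * S1)
        * (16 * (1 - beta) * (favg F x1 - fbar))).
Proof.
move=> m0 b0 nE dF GF _ L0 LG Fb almono be0 be1 lam0 lamB al T1 D S3 S1 gn2.
have DE : D = 10 / (1 - beta ^+ m) ^+ 2 * (L / (1 - beta)) ^+ 3 by [].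
clearbody D.
have n0 : (0 < n)%N by rewrite nE muln_gt0 m0.
have M0 : 0 < m%:R :> R by rewrite ltr0n.
have B0 : 0 < b%:R :> R by rewrite ltr0n.
have ob : 0 < 1 - beta by rewrite subr_gt0.
have rho0 : 0 < 1 - beta ^+ m by rewrite subr_gt0 exprn_ilt1 // -lt0n.
have D0 : 0 < D by rewrite DE mulr_gt0 ?divr_gt0 ?exprn_gt0 ?divr_gt0.
have desc i := descent_lemma L0 (dF i) (GF i) (LG i).
have LGsq i x y := lipschitz_normsq (LG i x y).
have al0 k : (1 <= k)%N -> 0 < alpha k by move=> /al [].
pose h k := alpha k / (1 - beta).
pose mu k := 2 * (h k * m%:R) * L ^+ 2 * (beta / (1 - beta)) ^+ 2 / (1 - beta ^+ m).
have h0 k : (1 <= k)%N -> 0 < h k by move=> k1; rewrite divr_gt0 ?al0.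
have hal k : alpha k = h k * (1 - beta) by rewrite /h divfK // gt_eqF.
have hu k : (1 <= k)%N -> 4 * (L * h k * m%:R) <= 1 - beta ^+ m.
  move=> k1; have [_] := al k k1; rewrite ler_pdivlMr ?mulr_gt0 // hal => H.
  by rewrite -(ler_pM2l ob); lra.
have mu0 k : (1 <= k)%N -> 0 <= mu k.
  move=> k1; have ak := ltW (al0 k k1).
  by rewrite /mu !mulr_ge0 ?invr_ge0 // ltW.
(* Non-increasing step sizes let the weight of the next epoch replace the current one at the end of
   an epoch. *)
have muS k : (1 <= k)%N -> mu k.+1 <= mu k.
  move=> k1; rewrite /mu !ler_wpM2r ?sqr_ge0 ?invr_ge0 ?(ltW rho0) ?(ltW M0) //.
  by rewrite ler_pM2l // !ler_wpM2r ?invr_ge0 ?(ltW ob) ?(ltW M0) // almono.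
pose Ly k st := lyapunov F fbar beta (mu k) st.
have Ly0 k st : (1 <= k)%N -> 0 <= Ly k st by move=> k1; apply: lyapunov_ge0 => //; exact: mu0.
(* The two initial points coincide, so the momentum term vanishes. *)
have Ly1 k : Ly k (x1, x1) = favg F x1 - fbar.
  by rewrite /Ly /lyapunov /shadow /= subrr scaler0 addr0 normsq0 mulr0 addr0.
have step kappa (P : pred 'S_n) k st : (1 <= k)%N -> 0 <= kappa ->
    (forall (a : 'I_n -> 'rV[R]_d) (w : nat -> R) (j : nat), \sum_i a i = 0 ->
     (forall l, 0 <= w l <= 1) -> (j <= m)%N ->
     \sum_(p | P p) normsq (\sum_(l < j) w l *: batch_mean b (fun i => a (p i)) l)
       <= #|P|%:R * (j%:R * (kappa * (n%:R^-1 * \sum_i normsq (a i))))) ->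
    \sum_(p | P p) Ly k.+1 (rrm_epoch G m b p (alpha k) beta lam st)
      + #|P|%:R * (alpha k / (1 - beta) * m%:R / 16 * normsq (gavg G st.2)) <=
    #|P|%:R * ((1 + 7 / 6 * (D * m%:R ^+ 2 * kappa * alpha k ^+ 3)) * Ly k st).
  move=> k1 kappa0 HP.
  have := rrm_epoch_mean st m0 b0 nE L0 desc LGsq Fb be0 be1 lam0 lamB (h0 k k1) (hu k k1)
    (erefl (mu k)) kappa0 HP.
  have -> : 10 / (1 - beta ^+ m) ^+ 2 * (L * h k) ^+ 3 * m%:R ^+ 2 * kappa =
      D * m%:R ^+ 2 * kappa * alpha k ^+ 3.
    by rewrite DE /h; field; rewrite !gt_eqF.
  rewrite -hal; apply: le_trans; rewrite lerD2r; apply: ler_sum => p _.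
  by apply: lyapunov_le; exact: muS.
split=> [HS pi|HS].
  have CE : D * m%:R ^+ 2 * m%:R = D * m%:R ^+ 3 by ring.
  have -> : 3 * D * m%:R ^+ 3 * S3 = 3 * (D * m%:R ^+ 2 * m%:R * S3) by ring.
  rewrite -(Ly1 1%N) -[(x1, x1)]/(rrm_st G m b pi alpha beta lam x1 0).
  (* Index [k.-1] gives the state before epoch [k]; the recursion comes from the singleton of
     [pi k], with [kappa = m]. *)
  apply: (rate_of_recursion (M := fun k => Ly k (rrm_st G m b pi alpha beta lam x1 k.-1))) => //.
  - by rewrite !mulr_ge0 // ltW.
  - by move=> k k1; exact: Ly0.
  - by move=> k; exact: sqr_ge0.
  - case=> [//|k] /andP[k1 _]; rewrite /gn2 enorm_sqr /rrm_x /=.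
    have := step _ (pred1 (pi k.+1)) k.+1 (rrm_st G m b pi alpha beta lam x1 k) isT
      (ler0n R m) (noise_bound_pred1 (pi k.+1) b0 nE m0).
    by rewrite big_pred1_eq card1 !mul1r.
  - by rewrite CE mulrC -ler_pdivlMr ?mul1r // mulr_gt0 // exprn_gt0.
have -> : 3 * D * m%:R ^+ 2 * b%:R^-1 * S3 = 3 * (D * m%:R ^+ 2 * b%:R^-1 * S3) by ring.
have -> : favg F x1 - fbar =
    Eperm T (fun pi => Ly 1%N (rrm_st G m b pi alpha beta lam x1 0)).
  rewrite /Eperm /= Ly1 sumr_const -[_ *+ #|_|]mulr_natl mulKf //.
  by rewrite pnatr_eq0 -lt0n; apply/card_gt0P; exists [ffun=> 1%g].
have K0 : 0 < #|{ffun 'I_T -> 'S_n}|%:R^-1 :> R.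
  by rewrite invr_gt0 ltr0n; apply/card_gt0P; exists [ffun=> 1%g].
apply: (rate_of_recursion
  (M := fun k => Eperm T (fun pi => Ly k (rrm_st G m b pi alpha beta lam x1 k.-1)))) => //.
- by rewrite !mulr_ge0 ?invr_ge0 // ltW.
- by move=> k k1; rewrite mulr_ge0 ?sumr_ge0 // ?(ltW K0) // => P _; exact: Ly0.
- by move=> k; rewrite mulr_ge0 ?sumr_ge0 // ?(ltW K0) // => P _; exact: sqr_ge0.
- case=> [//|k] /andP[k1 kT]; rewrite /Eperm /=.
  rewrite mulrCA -mulrDr [leRHS]mulrCA ler_pM2l //.
  (* Multiplying by the number of permutations makes room for a fresh [q] in epoch [k.+1]. For each
     [P] the state before that epoch is then fixed, and the one-epoch bound averaged over [q]
     applies with [kappa = 1 / b]. *)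
  have S0 : 0 < #|{: 'S_n}|%:R :> R by rewrite ltr0n; apply/card_gt0P; exists 1%g.
  rewrite -(ler_pM2l S0) mulrDr.
  rewrite -(sum_resample (Ordinal kT) (fun P =>
    Ly k.+2 (rrm_st G m b (perm_seq P) alpha beta lam x1 k.+1))).
  rewrite !mulr_sumr -big_split /=; apply: ler_sum => P _.
  rewrite (eq_bigr (fun q => Ly k.+2 (rrm_epoch G m b q (alpha k.+1) beta lam
    (rrm_st G m b (perm_seq P) alpha beta lam x1 k)))) => [|q _]; last first.
    congr (Ly _ _); exact: (rrm_st_resample m b G alpha beta lam x1 P (Ordinal kT)).
  have := step _ predT k.+1 (rrm_st G m b (perm_seq P) alpha beta lam x1 k) isT _
      (noise_bound_uniform b0 nE).
  rewrite invr_ge0 ler0n => /(_ isT).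
  by rewrite /gn2 enorm_sqr /rrm_x.
rewrite mulrC -ler_pdivlMr ?mulr_gt0 ?invr_gt0 ?exprn_gt0 //.
by rewrite mul1r invfM invrK mulrC.
Qed.
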